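(* Let $\mathbb{K}$ be a field, let $m\ge2$, let $\underline{\ell}=(\ell_1,\ldots,\ell_m)\in\mathbb{Z}_{>0}^m$, and let $G=\mathbf{G}_{2\underline{\ell}}$ be the multi-path graph of even type with paths of lengths $2\ell_1,\ldots,2\ell_m$. For $i\ge1$ and $j\ge1$ let \[ E_i^j=\{(k_1,\ldots,k_{i+1},r)\mid \ell_{k_1}+\cdots+\ell_{k_{i+1}}=j,\ 1\le k_1<\cdots<k_{i+1}\le m,\ 0\le r\le i-1\} \] (so $E_i^j=\emptyset$ for $i\ge m$). Then there is a monomial order $<$ on $\mathbb{K}[E(G)]$ such that $\mathrm{in}_<(I_G)$ is square-free, $\beta_i(\mathrm{in}_<(I_G))\le(i+1)\binom{m}{i+2}$ for all $i\ge0$, and \[ \beta_{i,j}(\mathbb{K}[G])=\beta_{i,j}\bigl(\mathbb{K}[E(G)]/\mathrm{in}_<(I_G)\bigr)=|E_i^j|\qquad\text{for all } i\ge1,\ j\ge1. \]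
   Context: For a finite simple graph $G$ with vertex set $V(G)$ and edge set $E(G)$, $\mathbb{K}[V(G)]$ and $\mathbb{K}[E(G)]$ are the polynomial rings with variables the vertices, respectively the edges, of $G$. The toric ideal $I_G$ is the kernel of $\phi:\mathbb{K}[E(G)]\to\mathbb{K}[V(G)]$, $e=\{x,y\}\mapsto xy$, and the edge ring is $\mathbb{K}[G]=\mathrm{im}\,\phi\cong\mathbb{K}[E(G)]/I_G$. Each edge variable has degree $1$; $\beta_{i,j}(M)=\dim_{\mathbb{K}}\mathrm{Tor}_i^{\mathbb{K}[E(G)]}(M,\mathbb{K})_j$ and $\beta_i(M)=\sum_j\beta_{i,j}(M)$. $\mathbf{G}_{2\underline{\ell}}$ is the simple graph consisting of $m$ paths of lengths (numbers of edges) $2\ell_1,\ldots,2\ell_m$, all starting at a common vertex $v_1$ and ending at a common vertex $v_2\ne v_1$, and pairwise having no common vertices except $v_1,v_2$. *)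

(* Defs.v *)
From HB Require Import structures.
From mathcomp Require Import all_boot all_order all_algebra.
From mathcomp Require Import mpoly.
From Stdlib Require Import ClassicalEpsilon.

Set Implicit Arguments.
Unset Strict Implicit.
Unset Printing Implicit Defensive.

Import GRing.Theory.
Local Open Scope ring_scope.

Section Ideals.
Variables (K : fieldType) (n : nat).
Local Notation S := {mpoly K[n]}.

Definition ideal_span (A : S -> Prop) : S -> Prop := fun p =>
  exists s : seq (S * S),
    (forall c, c \in s -> A c.2) /\ p = \sum_(c <- s) c.1 * c.2.

(* On exponent vectors, a total order that is compatible with addition and has
   [0] as its minimum is a well-order (Dickson). *)
Definition monomial_order (le : rel 'X_{1..n}) : Prop :=
  [/\ [/\ reflexive le, antisymmetric le, transitive le & total le],
      (forall u v w : 'X_{1..n}, le u v -> le (u + w)%MM (v + w)%MM)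
    & (forall u : 'X_{1..n}, le 0%MM u)].

Definition leading_monomial (le : rel 'X_{1..n}) (p : S) (u : 'X_{1..n}) :=
  u \in msupp p /\ (forall v, v \in msupp p -> le v u).

Definition initial_ideal (le : rel 'X_{1..n}) (I : S -> Prop) : S -> Prop :=
  ideal_span (fun q => exists p u,
    [/\ I p, leading_monomial le p u & q = 'X_[u]]).

Definition squarefree_ideal (I : S -> Prop) : Prop :=
  exists A : 'X_{1..n} -> Prop,
    (forall u, A u -> forall i : 'I_n, (u i <= 1)%N) /\
    (forall p, I p <-> ideal_span (fun q => exists2 u, A u & q = 'X_[u]) p).

End Ideals.

Section BettiNumbers.
Variables (K : fieldType) (n : nat).
Local Notation S := {mpoly K[n]}.

(* [F_i] is the free module of rank [rk i], seen as row vectors, whose [a]-th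
   basis element has degree [deg a]; maps act by right multiplication. *)
Record gfree_complex := GFreeComplex {
  rk : nat -> nat;
  deg : forall i, 'I_(rk i) -> nat;
  diff : forall i, 'M[S]_(rk i.+1, rk i);
  aug : 'cV[S]_(rk 0)
}.

(* All maps have degree 0. *)
Definition graded_maps (F : gfree_complex) : Prop :=
  (forall i a b u, u \in msupp (diff F i a b) ->
     (mdeg u + deg b = deg a)%N) /\
  (forall a u, u \in msupp (aug F a 0) -> mdeg u = deg a).

(* [F] is a graded free resolution of the graded module [J / I], where
   [I <= J] are homogeneous ideals of [S]; the augmentation [F_0 -> J / I] is
   given by representatives in [J] of the images of the basis elements. *)
Definition graded_free_resolution (F : gfree_complex) (J I : S -> Prop) : Prop :=
  [/\ graded_maps F,
      (forall a, J (aug F a 0)),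
      (forall p, J p -> exists v : 'rV[S]_(rk F 0),
         I (p - (v *m aug F) 0 0)),
      (forall v : 'rV[S]_(rk F 0),
         I ((v *m aug F) 0 0) <-> exists w, v = w *m diff F 0)
    & (forall i (v : 'rV[S]_(rk F i.+1)),
         v *m diff F i = 0 <-> exists w, v = w *m diff F i.+1)].

(* Tensoring with [K = S / (X_0, ..., X_(n-1))] replaces the entries of the
   differentials by their constant coefficients. *)
Definition diffK (F : gfree_complex) i : 'M[K]_(rk F i.+1, rk F i) :=
  map_mx (fun p : S => p@_0%MM) (diff F i).

Definition cyclesK (F : gfree_complex) i : 'M[K]_(rk F i) :=
  if i is i'.+1 then kermx (diffK F i') else 1%:M.

(* Its row space is the degree [j] part of [F_i (x) K]. *)
Definition degpart (F : gfree_complex) i (j : nat) : 'M[K]_(rk F i) :=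
  diag_mx (\row_a (deg a == j)%:R).

(* dim_K H_i(F (x) K)_j *)
Definition homologyK (F : gfree_complex) (i j : nat) : nat :=
  (\rank (cyclesK F i :&: degpart F i j)%MS
    - \rank (diffK F i :&: degpart F i j)%MS)%N.

(* dim_K Tor_i(J / I, K)_j, computed from any graded free resolution. *)
Definition betti (J I : S -> Prop) (i j : nat) : nat :=
  epsilon (inhabits 0%N) (fun b =>
    exists F, graded_free_resolution F J I /\ homologyK F i j = b).

Definition betti_quot (I : S -> Prop) := betti (fun=> True) I.

Definition betti_ideal (I : S -> Prop) := betti I (fun p => p = 0).

End BettiNumbers.

Record sgraph := SGraph {
  vertex :> finType;
  adj : rel vertex;
  adj_sym : ssrbool.symmetric adj;
  adj_irr : irreflexive adj
}.

Definition edges (G : sgraph) : {set {set G}} :=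
  [set a : {set G} |
     [exists x : G, exists y : G, adj x y && (a == [set x; y])]].

(* [K[E(G)]] is [{mpoly K[#|edges G|]}], the [i]-th variable standing for the
   [i]-th edge of the enumeration of [edges G]; likewise for [K[V(G)]]. *)
Definition edge_monomial (K : fieldType) (G : sgraph) (i : 'I_#|edges G|) :
    {mpoly K[#|G|]} :=
  \prod_(x in enum_val i) 'X_(enum_rank x).

Definition edge_map (K : fieldType) (G : sgraph) :
    {mpoly K[#|edges G|]} -> {mpoly K[#|G|]} :=
  mmap (@mpolyC #|G| K) (@edge_monomial K G).

Definition toric_ideal (K : fieldType) (G : sgraph) :
    {mpoly K[#|edges G|]} -> Prop :=
  fun p => edge_map p = 0.

(* [G] consists of [m] paths from [v1] to [v2], the [k]-th one having [len k]
   edges and successive vertices [v1 :: P k]. *)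
Definition multipath_graph (m : nat) (len : 'I_m -> nat) (G : sgraph) : Prop :=
  exists (v1 v2 : G) (P : 'I_m -> seq G),
    [/\ v1 != v2,
        (forall k, [/\ path (@adj G) v1 (P k), last v1 (P k) = v2,
                       uniq (v1 :: P k) & size (P k) = len k]),
        (forall k k' x, k != k' -> x \in v1 :: P k -> x \in v1 :: P k' ->
           x = v1 \/ x = v2),
        (forall x, exists k, x \in v1 :: P k)
      & (forall x y, adj x y -> exists k,
           infix [:: x; y] (v1 :: P k) || infix [:: y; x] (v1 :: P k))].

Definition Eset (m : nat) (l : 'I_m -> nat) (i j : nat) :
    {set (i.+1).-tuple 'I_m * 'I_i} :=
  [set kr : (i.+1).-tuple 'I_m * 'I_i |
     sorted (fun k k' : 'I_m => (k < k')%N) kr.1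
     && ((\sum_(k <- kr.1) l k)%N == j)].

(* Main.v *)
(* Let a_k and b_k be the products of the edge variables of the k-th path in odd
   and in even position. Then I_G is generated by the 2-minors a_j b_k - a_k b_j
   of a 2 x m matrix, and for a weight that makes a_1, ..., a_m decreasing its
   initial ideal is generated by the a_j b_k with j < k.

   Both quotients are resolved by the same free modules: the Eagon-Northcott
   differential acquires a parameter t whose exponents are drops in weight, so
   that t = 1 gives I_G and t = 0 gives the initial ideal. Exactness is proved
   for all t at once by matching the monomials of consecutive free modules in
   such a way that the differential of a matched monomial has its partner as
   leading term; monomials left unmatched in degree 0 are the standard ones, and
   they are sent to distinct monomials in K[V(G)]. As the entries have no
   constant terms, the Betti numbers count basis elements: (#A - 1) for every
   column set A, in degree the sum of the l_k over A. *)

Require Import Defs.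
From mathcomp Require Import all_boot all_order all_algebra.
From mathcomp Require Import mpoly.
From mathcomp Require Import zify.
From Stdlib Require Import ClassicalEpsilon.

Set Implicit Arguments.
Unset Strict Implicit.
Unset Printing Implicit Defensive.

Import GRing.Theory.

(** * Independence of the Betti numbers of the resolution *)

Section Comparison.
Local Open Scope ring_scope.
Variables (K : fieldType) (n : nat).
Local Notation S := {mpoly K[n]}.

(** The Betti numbers of the two quotients agree without any semicontinuity argument, because one
    family of matrices is exact for every [t]. A matched pair of terms always shares a multidegree.
    For [t = 1] the differential no longer respects multidegrees, but the weight survives as a
    filtration: the power of [t] in front of a term is exactly the weight that the term loses.
    Leading terms are thus the same for all [t], and since weights are natural numbers, reduction
    terminates. Weight on the first edge of each path is enough. Two monomials with the same image
    in K[V(G)] differ along a path by one number with alternating signs, so the first edges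
    determine all others. Since [betti] chooses an arbitrary resolution, none of this yields a Betti
    number before any two resolutions are known to give the same homology. *)

Definition ideal_closed (I : S -> Prop) : Prop :=
  [/\ I 0, (forall p q, I p -> I q -> I (p + q)) & (forall p q, I q -> I (p * q))].

(* [b] is the degree of the basis element of which [p] is a coefficient. *)
Definition hcomp (e b : nat) (p : S) : S :=
  \sum_(u <- msupp p | (mdeg u + b == e)%N) p@_u *: 'X_[u].

Definition homogeneous_ideal (I : S -> Prop) : Prop :=
  forall p e, I p -> I (hcomp e 0 p).

Definition mxgraded r1 r0 (d1 : 'I_r1 -> nat) (d0 : 'I_r0 -> nat)
    (A : 'M[S]_(r1, r0)) : Prop :=
  forall a b u, u \in msupp (A a b) -> (mdeg u + d0 b = d1 a)%N.

Lemma mcoeff_hcomp e b p v :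
  (hcomp e b p)@_v = if (mdeg v + b == e)%N then p@_v else 0.
Proof.
rewrite /hcomp raddf_sum /= (eq_bigr (fun u => p@_u * (u == v)%:R)); last first.
  by move=> u _; rewrite mcoeffZ mcoeffX.
case: (boolP (v \in msupp p)) => hv.
  rewrite big_mkcond (bigD1_seq v) ?msupp_uniq //= big1 => [|u /negPf ->].
    by rewrite eqxx mulr1 addr0.
  by rewrite mulr0 if_same.
rewrite (memN_msupp_eq0 hv) if_same big_seq_cond big1 // => u /andP[hu _].
by case: eqP hu hv => [-> -> //|_ _ _]; rewrite mulr0.
Qed.

Lemma hcomp_mul e b c p q : (forall u, u \in msupp q -> (mdeg u + c = b)%N) ->
  hcomp e c (p * q) = hcomp e b p * q.
Proof.
move=> hq; apply/mpolyP => v; rewrite mcoeff_hcomp !mcoeffM.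
case: eqP => hv; first (apply: eq_bigr => k /eqP hk); last first.
  (rewrite big1 // => k /eqP hk).
all: rewrite mcoeff_hcomp.
all: have [/hq hb|/memN_msupp_eq0 ->] := boolP ((k.2 : 'X_{1..n}) \in msupp q);
  last by rewrite !mulr0.
all: by rewrite -hb addnA -mdegD -hk; case: eqP => h; rewrite ?mul0r.
Qed.

Lemma hcompD e b p q : hcomp e b (p + q) = hcomp e b p + hcomp e b q.
Proof.
by apply/mpolyP => v; rewrite mcoeffD !mcoeff_hcomp; case: eqP; rewrite ?addr0 ?mcoeffD.
Qed.

Lemma hcompN e b p : hcomp e b (- p) = - hcomp e b p.
Proof.
by apply/mpolyP => v; rewrite mcoeffN !mcoeff_hcomp; case: eqP; rewrite ?oppr0 ?mcoeffN.
Qed.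

Lemma hcomp_sum e b (T : finType) (F : T -> S) :
  hcomp e b (\sum_i F i) = \sum_i hcomp e b (F i).
Proof.
apply: (big_morph (hcomp e b) (hcompD e b)).
by apply/mpolyP => v; rewrite mcoeff_hcomp mcoeff0 if_same.
Qed.

Lemma hcomp_id e b p : (forall u, u \in msupp p -> (mdeg u + b = e)%N) ->
  hcomp e b p = p.
Proof.
move=> hp; apply/mpolyP => v; rewrite mcoeff_hcomp.
case: ifP => // /negP he; rewrite memN_msupp_eq0 //; apply/negP => /hp hv.
by apply: he; apply/eqP.
Qed.

Lemma msupp_hcomp e b p u : u \in msupp (hcomp e b p) -> (mdeg u + b = e)%N.
Proof. by rewrite mcoeff_msupp mcoeff_hcomp; case: ifP => [/eqP//|_]; rewrite eqxx. Qed.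

Lemma hcomp_mulmx r1 r0 (d1 : 'I_r1 -> nat) (d0 : 'I_r0 -> nat)
    (D : 'M[S]_(r1, r0)) (w : 'rV[S]_r1) e : mxgraded d1 d0 D ->
  (\row_a hcomp e (d1 a) (w 0 a)) *m D = \row_b hcomp e (d0 b) ((w *m D) 0 b).
Proof.
move=> hD; apply/rowP => b; rewrite !mxE hcomp_sum; apply: eq_bigr => a _.
by rewrite mxE (@hcomp_mul e (d1 a)) // => u; apply: hD.
Qed.

(** Any lift can be made graded: as [D] has degree 0, the homogeneous components of the required
    degrees still lift [X]. *)
Lemma graded_lift r r1 r0 (d : 'I_r -> nat) (d1 : 'I_r1 -> nat)
    (d0 : 'I_r0 -> nat) (D : 'M[S]_(r1, r0)) (X : 'M[S]_(r, r0)) :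
  mxgraded d1 d0 D -> mxgraded d d0 X -> (forall a, exists w, row a X = w *m D) ->
  exists Y : 'M[S]_(r, r1), X = Y *m D /\ mxgraded d d1 Y.
Proof.
move=> hD hX /fin_all_exists[w hw].
exists (\matrix_(a, b) hcomp (d a) (d1 b) (w a 0 b)); split; last first.
  by move=> a b u; rewrite mxE; apply: msupp_hcomp.
apply/row_matrixP => a; rewrite row_mul.
rewrite (_ : row a (\matrix_(a, b) _) = \row_b hcomp (d a) (d1 b) (w a 0 b)); last first.
  by apply/rowP => b; rewrite !mxE.
rewrite (hcomp_mulmx _ _ hD) -hw; apply/rowP => b; rewrite !mxE hcomp_id //.
exact: hX.
Qed.

Lemma lift_rows r r1 r0 (D : 'M[S]_(r1, r0)) (X : 'M[S]_(r, r0)) :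
  (forall a, exists w, row a X = w *m D) -> exists Y : 'M[S]_(r, r1), X = Y *m D.
Proof.
move=> /fin_all_exists[w hw]; exists (\matrix_a w a).
by apply/row_matrixP => a; rewrite row_mul rowK hw.
Qed.

Lemma mxgraded_mul r2 r1 r0 (d2 : 'I_r2 -> nat) (d1 : 'I_r1 -> nat)
    (d0 : 'I_r0 -> nat) (A : 'M[S]_(r2, r1)) (B : 'M[S]_(r1, r0)) :
  mxgraded d2 d1 A -> mxgraded d1 d0 B -> mxgraded d2 d0 (A *m B).
Proof.
move=> hA hB a b u; rewrite mxE => /msupp_sum_le/flatten_mapP[c _].
move=> /msuppM_le/allpairsP[[v w] [/= /hA hv /hB hw ->]].
by rewrite mdegD; lia.
Qed.

(** * Chain maps between two resolutions *)

Section ChainMap.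
Variables (J I : S -> Prop) (F M : gfree_complex K n).
Hypotheses (hI : ideal_closed I) (hIh : homogeneous_ideal I).
Hypotheses (hF : graded_free_resolution F J I) (hM : graded_free_resolution M J I).

Lemma ideal_opp p : I p -> I (- p).
Proof. by case: hI => _ _ hmul hp; rewrite -mulN1r; apply: hmul. Qed.

Lemma ideal_sum (T : finType) (f : T -> S) : (forall i, I (f i)) -> I (\sum_i f i).
Proof.
case: hI => h0 hadd _ hf; apply: (big_ind I) => // i _; exact: hf.
Qed.

Lemma res_diff2 i : diff F i.+1 *m diff F i = 0.
Proof.
case: hF => _ _ _ _ h; apply/row_matrixP => a.
rewrite row_mul row0; apply/h; exists (delta_mx 0 a).
by rewrite rowE.
Qed.

Lemma res_diff0 a : I ((diff F 0 *m aug F) a 0).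
Proof.
case: hF => _ _ _ h _; rewrite -[X in I X](_ : (row a (diff F 0) *m aug F) 0 0 = _).
  by apply/h; exists (delta_mx 0 a); rewrite rowE.
by rewrite -row_mul mxE.
Qed.

(** The congruences modulo [I] may be restricted to the component of degree [deg a] because [I] is
    homogeneous. *)
Lemma chain_map0 : exists f : 'M[S]_(rk F 0, rk M 0),
  (forall a, I ((aug F - f *m aug M) a 0)) /\ mxgraded (@deg _ _ F 0) (@deg _ _ M 0) f.
Proof.
case: hF => -[_ gF] JF _ _ _; case: hM => -[_ gM] _ sM _ _.
have /fin_all_exists[v hv] : forall a, exists v : 'rV[S]_(rk M 0),
    I (aug F a 0 - (v *m aug M) 0 0) by move=> a; apply: sM; apply: JF.
exists (\matrix_(a, b) hcomp (deg a) (deg b) (v a 0 b)); split; last first.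
  by move=> a b u; rewrite mxE; apply: msupp_hcomp.
move=> a; have := hIh (deg a) (hv a); rewrite hcompD hcompN hcomp_id; last first.
  by move=> u /gF; rewrite addn0.
rewrite !mxE hcomp_sum; congr (I (_ - _)); apply: eq_bigr => b _.
rewrite !mxE (@hcomp_mul _ (deg b)) // => u; rewrite addn0; exact: gM.
Qed.

Variable f0 : 'M[S]_(rk F 0, rk M 0).
Hypothesis f0P : forall a, I ((aug F - f0 *m aug M) a 0).
Hypothesis f0g : mxgraded (@deg _ _ F 0) (@deg _ _ M 0) f0.

(** Each map is a graded lift, through [M], of a composite with the previous choice; hence [epsilon]
    inside the recursion. *)
Fixpoint chain_map i : 'M[S]_(rk F i, rk M i) :=
  if i is i'.+1 then
    epsilon (inhabits 0) (fun Y => diff F i' *m chain_map i' = Y *m diff M i' /\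
      mxgraded (@deg _ _ F i'.+1) (@deg _ _ M i'.+1) Y)
  else f0.

Lemma chain_mapP i :
  mxgraded (@deg _ _ F i) (@deg _ _ M i) (chain_map i) /\
  diff F i *m chain_map i = chain_map i.+1 *m diff M i.
Proof.
have [[gF _] _ _ _ _] := hF; have [[gM _] _ _ eM0 eM] := hM.
have step j : mxgraded (@deg _ _ F j) (@deg _ _ M j) (chain_map j) ->
    (forall a, exists w, row a (diff F j *m chain_map j) = w *m diff M j) ->
    diff F j *m chain_map j = chain_map j.+1 *m diff M j /\
    mxgraded (@deg _ _ F j.+1) (@deg _ _ M j.+1) (chain_map j.+1).
  move=> gj /graded_lift hj; have := hj _ _ _ (gM j) (mxgraded_mul (gF j) gj).
  by move=> /(epsilon_spec (inhabits 0)).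
suff [gi hi] : mxgraded (@deg _ _ F i) (@deg _ _ M i) (chain_map i) /\
    (forall a, exists w, row a (diff F i *m chain_map i) = w *m diff M i).
  by split=> //; have [] := step i gi hi.
elim: i => [|i [gi hi]]; last first.
  have [eqi gi1] := step i gi hi; split=> // a; apply/eM.
  by rewrite -row_mul -mulmxA -eqi mulmxA res_diff2 mul0mx row0.
split=> // a; apply/eM0.
case: hI => _ hadd hmul.
(* [f0] commutes with the augmentations only modulo [I]; the defect is a combination of the elements
   in [f0P]. *)
rewrite -[X in I X](_ : (diff F 0 *m aug F) a 0
     - \sum_b diff F 0 a b * (aug F - f0 *m aug M) b 0 = _).
  apply: hadd; first exact: res_diff0.
  by apply: ideal_opp; apply: ideal_sum => b; apply: hmul; apply: f0P.
rewrite -row_mul [RHS]mxE -mulmxA.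
rewrite (_ : \sum_b _ = (diff F 0 *m (aug F - f0 *m aug M)) a 0); last by rewrite mxE.
have subBK (A C : 'cV[S]_(rk F 1)) : A a 0 - (A - C) a 0 = C a 0.
  by rewrite !mxE opprB addrC subrK.
by rewrite mulmxBr subBK.
Qed.

End ChainMap.

(** * Homotopies to zero *)

Section Homotopy.
Variables (J I : S -> Prop) (F : gfree_complex K n).
Hypothesis hF : graded_free_resolution F J I.
Variable c : forall i, 'M[S]_(rk F i).
Hypothesis c0P : forall a, I ((c 0 *m aug F) a 0).
Hypothesis cP : forall i, diff F i *m c i = c i.+1 *m diff F i.

(** Degrees are not tracked here: the homotopy only shows that a cycle is a boundary, and the degree
    of that cycle is known already. *)
Fixpoint homotopy i : 'M[S]_(rk F i, rk F i.+1) :=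
  match i with
  | 0 => epsilon (inhabits 0) (fun h => c 0 = h *m diff F 0)
  | i'.+1 => epsilon (inhabits 0)
      (fun h => c i'.+1 - diff F i' *m homotopy i' = h *m diff F i'.+1)
  end.

Lemma homotopy0 : c 0 = homotopy 0 *m diff F 0.
Proof.
have [_ _ _ e0 _] := hF; apply: (epsilon_spec _ (fun h => c 0 = h *m diff F 0)).
apply: lift_rows => a; apply/e0; rewrite -row_mul mxE; exact: c0P.
Qed.

Lemma homotopyS i :
  c i.+1 = diff F i *m homotopy i + homotopy i.+1 *m diff F i.+1.
Proof.
have [_ _ _ _ e] := hF.
have step j : (c j.+1 - diff F j *m homotopy j) *m diff F j = 0 ->
    c j.+1 - diff F j *m homotopy j = homotopy j.+1 *m diff F j.+1.
  move=> hj; apply: (epsilon_spec _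
    (fun h => c j.+1 - diff F j *m homotopy j = h *m diff F j.+1)).
  by apply: lift_rows => a; apply/e; rewrite -row_mul hj row0.
apply/eqP; rewrite addrC -subr_eq; apply/eqP; elim: i => [|i IHi].
  by apply: step; rewrite mulmxBl -mulmxA -homotopy0 cP subrr.
apply: step; rewrite mulmxBl -mulmxA -IHi -cP mulmxBr mulmxA (res_diff2 hF).
by rewrite mul0mx subr0 subrr.
Qed.

End Homotopy.

(** The last hypothesis puts the kernel of the map from [Z] to the quotient by [B'] inside [B]; the
    rest is rank-nullity for [f *m cokermx B']. *)
Lemma mxrank_quot_le p q (Z B : 'M[K]_p) (Z' B' : 'M[K]_q) (f : 'M[K]_(p, q)) :
  (B' <= Z')%MS -> (Z *m f <= Z')%MS ->
  (forall x : 'rV_p, (x <= Z)%MS -> (x *m f <= B')%MS -> (x <= B)%MS) ->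
  (\rank Z - \rank B <= \rank Z' - \rank B')%N.
Proof.
move=> hB' hZ hinj; pose g := f *m cokermx B'.
have /mxrankS : (Z :&: kermx g <= B)%MS.
  apply/rV_subP => x; rewrite sub_capmx => /andP[xZ /sub_kermxP].
  by rewrite mulmxA => /eqP xB; apply: hinj => //; rewrite submxE.
have /mxrankS : (Z *m g <= Z' *m cokermx B')%MS by rewrite mulmxA submxMr.
have /mxrankS : (B' <= Z' :&: kermx (cokermx B'))%MS.
  by rewrite sub_capmx hB'; apply/sub_kermxP; rewrite mulmx_coker.
move: (mxrank_mul_ker Z g) (mxrank_mul_ker Z' (cokermx B')).
lia.
Qed.

Definition kmx r1 r0 (A : 'M[S]_(r1, r0)) : 'M[K]_(r1, r0) :=
  map_mx (mcoeff 0%MM) A.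

Lemma kmxM r2 r1 r0 (A : 'M[S]_(r2, r1)) (B : 'M[S]_(r1, r0)) :
  kmx (A *m B) = kmx A *m kmx B.
Proof. exact: map_mxM. Qed.

Lemma degpart_comm (F M : gfree_complex K n) i j (f : 'M[S]_(rk F i, rk M i)) :
  mxgraded (@deg _ _ F i) (@deg _ _ M i) f ->
  degpart F i j *m kmx f = kmx f *m degpart M i j.
Proof.
move=> gf; apply/matrixP => a b; rewrite /degpart mul_diag_mx mul_mx_diag !mxE.
rewrite mulrC; have [/gf|/memN_msupp_eq0 ->] := boolP (0%MM \in msupp (f a b)).
  by rewrite mdeg0 add0n => ->.
by rewrite !mul0r.
Qed.

(** For comparison maps [f], [g] the map [1 - f g] is homotopic to 0, so a cycle that [f] sends to a
    boundary is a boundary. Equality follows by exchanging [F] and [M]. *)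
Lemma homologyK_le (J I : S -> Prop) (F M : gfree_complex K n) i j :
  ideal_closed I -> homogeneous_ideal I ->
  graded_free_resolution F J I -> graded_free_resolution M J I ->
  (homologyK F i j <= homologyK M i j)%N.
Proof.
move=> hI hIh hF hM.
have [f0 [f0P f0g]] := chain_map0 hIh hF hM.
have [g0 [g0P g0g]] := chain_map0 hIh hM hF.
pose f := chain_map f0; pose g := chain_map g0.
have fP k : _ /\ diff F k *m f k = f k.+1 *m diff M k :=
  chain_mapP hI hF hM f0P f0g k.
have gP k : _ /\ diff M k *m g k = g k.+1 *m diff F k :=
  chain_mapP hI hM hF g0P g0g k.
pose c k : 'M[S]_(rk F k) := 1%:M - f k *m g k.
have c0 a : I ((c 0 *m aug F) a 0).
  have [_ hadd hmul] := hI.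
  rewrite [c 0]/c mulmxBl mul1mx -mulmxA.
  rewrite -[X in I X](_ : (aug F - f0 *m aug M) a 0
     + \sum_b f0 a b * (aug M - g0 *m aug F) b 0 = _).
    by apply: hadd => //; apply: (ideal_sum hI) => b; apply: hmul.
  rewrite (_ : \sum_b _ = (f0 *m (aug M - g0 *m aug F)) a 0); last by rewrite mxE.
  by rewrite mulmxBr !mxE addrA subrK.
have cP k : diff F k *m c k = c k.+1 *m diff F k.
  rewrite /c mulmxBl mulmxBr mulmx1 mul1mx mulmxA (proj2 (fP k)).
  by rewrite -!mulmxA (proj2 (gP k)).
have cK0 := homotopy0 hF c0; have cKS := homotopyS hF c0 cP.
set h := homotopy c in cK0 cKS.
have cKe k : kmx (c k) = 1%:M - kmx (f k) *m kmx (g k).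
  by rewrite /c /kmx map_mxB map_mxM map_mx1.
have idK k (x : 'rV_(rk F k)) : x = x *m kmx (f k) *m kmx (g k) + x *m kmx (c k).
  by rewrite cKe mulmxBr mulmx1 mulmxA addrC subrK.
have fK k : diffK F k *m kmx (f k) = kmx (f k.+1) *m diffK M k.
  by have := congr1 (@kmx _ _) (proj2 (fP k)); rewrite !kmxM.
have gK k : diffK M k *m kmx (g k) = kmx (g k.+1) *m diffK F k.
  by have := congr1 (@kmx _ _) (proj2 (gP k)); rewrite !kmxM.
have zB k : (diffK M k <= cyclesK M k)%MS.
  case: k => [|k]; rewrite /cyclesK ?submx1 //; apply/sub_kermxP.
  by have := congr1 (@kmx _ _) (res_diff2 hM k); rewrite kmxM /kmx map_mx0.
apply: (@mxrank_quot_le _ _ _ _ _ _ (kmx (f i))).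
- by apply: capmxS.
- apply/rV_subP => y /submxP[x ->]; rewrite mulmxA sub_capmx.
  have : (x *m (cyclesK F i :&: degpart F i j) <= cyclesK F i :&: degpart F i j)%MS.
    exact: submxMl.
  move: (x *m _) => {}x; rewrite sub_capmx => /andP[xZ /submxP[w xw]].
  have -> : (x *m kmx (f i) <= degpart M i j)%MS.
    by rewrite xw -mulmxA (degpart_comm _ (proj1 (fP i))) mulmxA submxMl.
  rewrite andbT.
  case: i {y w} x xZ {xw} => [|i] x; rewrite /cyclesK ?submx1 // => /sub_kermxP xd.
  by apply/sub_kermxP; rewrite -mulmxA -fK mulmxA xd mul0mx.
- move=> x; rewrite !sub_capmx => /andP[xZ ->] /andP[/submxP[w xf] _].
  rewrite andbT (idK i x) addmx_sub //.
    by rewrite xf -mulmxA gK mulmxA submxMl.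
  case: i x xZ {w xf} => [|i] x; rewrite /cyclesK.
    by move=> _; rewrite cK0 kmxM mulmxA submxMl.
  move=> /sub_kermxP xd; rewrite cKS /kmx raddfD /= -!/(kmx _) !kmxM mulmxDr.
  by rewrite !mulmxA xd mul0mx add0r submxMl.
Qed.

Lemma betti_eq (J I : S -> Prop) (M : gfree_complex K n) i j :
  ideal_closed I -> homogeneous_ideal I -> graded_free_resolution M J I ->
  betti J I i j = homologyK M i j.
Proof.
move=> hI hIh hM; rewrite /betti.
have [|F [hF <-]] := epsilon_spec (inhabits 0%N)
    (fun b => exists F, graded_free_resolution F J I /\ homologyK F i j = b).
  by exists (homologyK M i j), M.
by apply/eqP; rewrite eqn_leq !(@homologyK_le J I).
Qed.

(** The matrix is the product of [A] and [A^T], where the columns of [A] are the unit vectors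
    selected by [P], so [A^T *m A = 1]. *)
Lemma rank_indicator_diag r (P : pred 'I_r) :
  \rank (diag_mx (\row_a (P a)%:R : 'rV[K]_r)) = #|P|.
Proof.
pose A : 'M[K]_(r, #|P|) := \matrix_(a, k) (a == enum_val k)%:R.
have AtA : A^T *m A = 1%:M.
  apply/matrixP => k l; rewrite !mxE (bigD1 (enum_val k)) //= big1 => [|a /negPf ha].
    by rewrite !mxE eqxx mul1r addr0 (inj_eq enum_val_inj).
  by rewrite !mxE ha mul0r.
have -> : diag_mx (\row_a (P a)%:R) = A *m A^T.
  apply/matrixP => a b; rewrite !mxE; case: (boolP (P a)) => Pa; last first.
    rewrite mul0rn big1 // => k _; rewrite !mxE; case: eqP => [ak|]; last by rewrite mul0r.
    by move: Pa; rewrite ak; have := enum_valP k; rewrite unfold_in => ->.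
  rewrite (bigD1 (enum_rank_in Pa a)) //= big1 => [|k hk].
    by rewrite !mxE enum_rankK_in // eqxx mul1r addr0 eq_sym.
  rewrite !mxE; case: eqP => [ak|]; last by rewrite mul0r.
  by case/eqP: hk; apply: enum_val_inj; rewrite enum_rankK_in.
apply/eqP; rewrite eqn_leq (leq_trans (mxrankM_maxl _ _)) ?rank_leq_col //=.
have E : A^T *m (A *m A^T) *m A = 1%:M by rewrite mulmxA AtA mul1mx.
have := mxrankM_maxl (A^T *m (A *m A^T)) A; rewrite E mxrank1 => /leq_trans.
by apply; apply: mxrankM_maxr.
Qed.

Lemma homologyK_minimal (M : gfree_complex K n) i j :
  (forall k, diffK M k = 0) -> homologyK M i j = #|[pred a | @deg _ _ M i a == j]|.
Proof.
move=> hM; rewrite /homologyK hM cap0mx mxrank0 subn0.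
have /capmx_idPr -> : (degpart M i j <= cyclesK M i)%MS.
  by case: i => [|i]; rewrite /cyclesK ?submx1 // hM kermx0 submx1.
exact: rank_indicator_diag.
Qed.

End Comparison.
(** * Exactness from a matching of terms *)

Section Matching.
Local Open Scope ring_scope.
Variables (K : fieldType) (n : nat).
Local Notation S := {mpoly K[n]}.
Local Notation mon := 'X_{1..n}.

Definition terms r (z : 'rV[S]_r) : seq (mon * 'I_r) :=
  [seq (u, b) | b <- enum 'I_r, u <- msupp (z 0 b)].

Lemma mem_terms r (z : 'rV[S]_r) u b : ((u, b) \in terms z) = ((z 0 b)@_u != 0).
Proof.
rewrite -mcoeff_msupp; apply/allpairsPdep/idP => [[b' [u' [_ hu [-> ->]]]]//|hu].
by exists b, u; rewrite mem_enum.
Qed.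

Variables (r1 r0 : nat) (M : 'M[S]_(r1, r0)) (mu : mon -> 'I_r0 -> nat).

(** A leading term for a measure in place of a term order: [mu] may have ties, but not at the top of
    this image. *)
Definition leads (u : mon) (a : 'I_r1) (v : mon) (b : 'I_r0) : Prop :=
  ('X_[u] * M a b)@_v != 0 /\
  (forall v' b', ('X_[u] * M a b')@_v' != 0 -> (v', b') <> (v, b) ->
     (mu v' b' < mu v b)%N).

(** Terms in [D] of maximal measure are cancelled one by one; each cancellation creates only terms
    of smaller measure. *)
Lemma matching_reduce (D : mon -> 'I_r0 -> Prop) :
  (forall v b, D v b -> exists u a, leads u a v b) ->
  forall z : 'rV[S]_r0, exists w, forall v b, D v b -> ((z - w *m M) 0 b)@_v = 0.
Proof.
move=> hD.
suff main N (z : 'rV[S]_r0) :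
    (forall v b, D v b -> (z 0 b)@_v != 0 -> (mu v b < N)%N) ->
    exists w, forall v b, D v b -> ((z - w *m M) 0 b)@_v = 0.
  move=> z; apply: (main (\max_(t <- terms z) (mu t.1 t.2).+1)%N).
  move=> v b _; rewrite -mem_terms => hvb.
  exact: (@leq_bigmax_seq _ _ xpredT (fun t : mon * 'I_r0 => (mu t.1 t.2).+1) _ hvb).
elim: N z => [|N IHN] z hz.
  exists 0 => v b hvb; rewrite mul0mx subr0; apply/eqP; apply: contraT.
  by move=> /(hz _ _ hvb).
(* The inner induction runs over a list containing all terms of measure exactly [N] that are still
   to be cancelled. *)
suff step (s : seq (mon * 'I_r0)) (y : 'rV[S]_r0) :
    (forall v b, D v b -> (y 0 b)@_v != 0 ->
       (mu v b < N)%N \/ mu v b = N /\ (v, b) \in s) ->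
    exists w, forall v b, D v b -> ((y - w *m M) 0 b)@_v = 0.
  apply: (step (terms z)) => v b hvb hne.
  have := hz v b hvb hne; rewrite ltnS leq_eqVlt => /predU1P[->|]; last by left.
  by right; rewrite mem_terms.
elim: s y => [|[v b] s IHs] y hy.
  by apply: IHN => v b hvb /(hy _ _ hvb)[|[]].
have [[hD' muN]|nD] := excluded_middle_informative (D v b /\ mu v b = N); last first.
  apply: IHs => v' b' hvb hne; have [->|[hN]] := hy v' b' hvb hne; [by left|].
  rewrite inE => /predU1P[[ev eb]|->]; last by right.
  by case: nD; rewrite -ev -eb.
have [u [a [lne lt]]] := hD v b hD'.
pose c := (y 0 b)@_v / ('X_[u] * M a b)@_v.
pose x : 'rV[S]_r1 := (c *: 'X_[u]) *: delta_mx 0 a.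
have xM b' : (x *m M) 0 b' = c *: ('X_[u] * M a b').
  by rewrite -scalemxAl -rowE !mxE -scalerAl.
have subE (A B : 'rV[S]_r0) b' : (A - B) 0 b' = A 0 b' - B 0 b' by rewrite !mxE.
have [w hw] : exists w, forall v b, D v b -> ((y - x *m M - w *m M) 0 b)@_v = 0.
  apply: IHs => v' b' hvb; rewrite subE xM mcoeffB mcoeffZ.
  have [[-> ->]|/eqP nvb] := eqVneq (v', b') (v, b).
    by rewrite /c divfK // subrr eqxx.
  have [->|/lt /(_ nvb)] := eqVneq ('X_[u] * M a b')@_v' 0.
    rewrite mulr0 subr0 => /(hy v' b' hvb)[->|[hN]]; [by left|].
    by rewrite inE => /predU1P[|->]; [|right].
  by rewrite muN => -> _; left.
by exists (x + w); rewrite mulmxDl opprD addrA.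
Qed.

Lemma leads_fun u a v b v' b' : leads u a v b -> leads u a v' b' -> (v, b) = (v', b').
Proof.
move=> [h1 lt1] [h2 lt2]; apply/eqP; apply: contraT => /eqP ne.
by have := lt1 _ _ h2 (nesym ne); have := lt2 _ _ h1 ne; lia.
Qed.

Variable R : mon -> 'I_r1 -> mon -> 'I_r0 -> Prop.
Hypothesis Rleads : forall u a v b, R u a v b -> leads u a v b.
Hypothesis Rinj : forall u a u' a' v b, R u a v b -> R u' a' v b -> (u, a) = (u', a').

(** A term of [z] whose partner has maximal measure cannot be cancelled there: another contributor
    would either have the same partner, against [Rinj], or a partner of larger measure. *)
Lemma matching_inj (z : 'rV[S]_r1) :
  (forall u a, (z 0 a)@_u != 0 -> exists v b, R u a v b) -> z *m M = 0 -> z = 0.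
Proof.
move=> hz zM.
have [N hN] : exists N, forall u a v b,
    (z 0 a)@_u != 0 -> R u a v b -> (mu v b < N)%N.
  suff [N hN] : exists N, forall u a v b,
      (u, a) \in terms z -> R u a v b -> (mu v b < N)%N.
    by exists N => u a v b; rewrite -mem_terms; apply: hN.
  elim: (terms z) => [|[u a] s [N hN]]; first by exists 0.
  have [[v [b hR]]|nR] := excluded_middle_informative (exists v b, R u a v b).
    exists (maxn N (mu v b).+1) => u' a' v' b'; rewrite inE leq_max.
    case/predU1P => [[-> ->]|/hN h /h ->] // hR'.
    by have [-> ->] := leads_fun (Rleads hR) (Rleads hR'); rewrite leqnn orbT.
  exists N => u' a' v' b'; rewrite inE => /predU1P[[-> ->] hR'|]; last exact: hN.
  by case: nR; exists v', b'.
elim: N hN => [|N IHN] hN.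
  apply/rowP => a; rewrite mxE; apply/mpolyP => u; rewrite mcoeff0.
  apply/eqP; apply: contraT => hu; have [v [b hR]] := hz _ _ hu.
  by have := hN _ _ _ _ hu hR.
apply: IHN => u a v b hu hR; have := hN _ _ _ _ hu hR.
rewrite ltnS leq_eqVlt => /predU1P[muN|//]; exfalso.
have [lne lt] := Rleads hR.
have: ((z *m M) 0 b)@_v = (z 0 a)@_u * ('X_[u] * M a b)@_v.
  have expand a' : (z 0 a' * M a' b)@_v =
      \sum_(u' <- msupp (z 0 a')) (z 0 a')@_u' * ('X_[u'] * M a' b)@_v.
    rewrite [X in X * _]mpolyE mulr_suml raddf_sum /=; apply: eq_bigr => u' _.
    by rewrite -scalerAl mcoeffZ.
  have vanish u' a' : (u', a') != (u, a) -> u' \in msupp (z 0 a') ->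
      (z 0 a')@_u' * ('X_[u'] * M a' b)@_v = 0.
    move=> /eqP ne; rewrite mcoeff_msupp => hu'; apply/eqP.
    rewrite mulf_eq0 (negPf hu') /=; apply: contraT => hne.
    have [v' [b' hR']] := hz _ _ hu'.
    have [_ lt'] := Rleads hR'.
    have [[ev eb]|/eqP/(lt' _ _ hne)] := eqVneq (v, b) (v', b').
      by case: ne; rewrite ev eb in hR; apply: Rinj hR' hR.
    by rewrite muN ltnNge -ltnS (hN _ _ _ _ hu' hR').
  rewrite mxE raddf_sum /= (bigD1 a) //= [X in _ + X]big1 => [|a' ne]; last first.
    rewrite expand big_seq big1 // => u'; apply: vanish.
    by apply: contraNneq ne => -[_ ->].
  rewrite addr0 expand (bigD1_seq u) ?msupp_uniq //=; last by rewrite mcoeff_msupp.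
  rewrite big_seq_cond big1 ?addr0 // => u' /andP[hu' ne]; apply: vanish => //.
  by apply: contraNneq ne => -[->].
rewrite zM mxE mcoeff0 => /esym/eqP; rewrite mulf_eq0.
by rewrite (negPf hu) (negPf lne).
Qed.

End Matching.

(* A cycle is reduced modulo the image until no term in the range of [R'] is
   left; the remaining terms have distinct leading terms, hence vanish. *)
Lemma matching_exact (K : fieldType) n r2 r1 r0 (M' : 'M[{mpoly K[n]}]_(r2, r1))
    (M : 'M[{mpoly K[n]}]_(r1, r0)) mu' mu
    (R' : 'X_{1..n} -> 'I_r2 -> 'X_{1..n} -> 'I_r1 -> Prop)
    (R : 'X_{1..n} -> 'I_r1 -> 'X_{1..n} -> 'I_r0 -> Prop) :
  (M' *m M = 0)%R ->
  (forall u a v b, R' u a v b -> leads M' mu' u a v b) ->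
  (forall u a v b, R u a v b -> leads M mu u a v b) ->
  (forall u a u' a' v b, R u a v b -> R u' a' v b -> (u, a) = (u', a')) ->
  (forall u a, (exists v b, R u a v b) \/ (exists u' a', R' u' a' u a)) ->
  forall z : 'rV_r1, (z *m M = 0)%R -> exists w, z = (w *m M')%R.
Proof.
move=> M'M R'l Rl Rinj cover z zM.
have [w hw] := @matching_reduce _ _ _ _ M' mu' (fun u a => exists u' a', R' u' a' u a)
  (fun v b '(ex_intro u (ex_intro a h)) => ex_intro _ u (ex_intro _ a (R'l _ _ _ _ h))) z.
exists w; apply/eqP; rewrite -GRing.subr_eq0; apply/eqP.
apply: (matching_inj Rl Rinj) => [u a|].
  by have [//|/hw ->] := cover u a; rewrite eqxx.
by rewrite mulmxBl zM -mulmxA M'M mulmx0 GRing.subr0.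
Qed.
(** * A deformation of the Eagon-Northcott complex *)

(** The separate hypothesis on the diagonal covers characteristic 2. *)
Lemma sum_antisym (V : zmodType) m (f : 'I_m -> 'I_m -> V) :
  (forall j k, f j k = - f k j)%R -> (forall k, f k k = 0)%R ->
  (\sum_j \sum_k f j k = 0)%R.
Proof.
move=> fN f0.
have split_row j : (\sum_k f j k =
    \sum_(k : 'I_m | (j < k)%N) f j k + \sum_(k : 'I_m | (k < j)%N) f j k)%R.
  rewrite (bigID (fun k : 'I_m => (j < k)%N)) /=; congr (_ + _)%R.
  rewrite (bigD1 j) ?ltnn //= f0 GRing.add0r; apply: eq_bigl => k.
  by rewrite -(inj_eq val_inj) /=; lia.
under eq_bigr do rewrite split_row.
rewrite big_split /= [X in (_ + X)%R](exchange_big_dep xpredT) //= -big_split /=.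
rewrite big1 // => j _; rewrite -big_split /= big1 // => k _.
by rewrite fN GRing.addNr.
Qed.

(** * Weights of column sets *)

Section Cells.
Variable m : nat.
Implicit Types (A : {set 'I_m}) (k j s : 'I_m).

Definition pos A k : nat := #|[set j in A | j < k]|.
Definition cnt A s : nat := #|[set j in A | j <= s]|.

Lemma card_sep A k (P : pred 'I_m) : k \in A ->
  #|[set j in A | P j]| = P k + #|[set j in A :\ k | P j]|.
Proof.
move=> kA; rewrite (cardsD1 k) inE kA /=; congr (_ + _).
by apply: eq_card => j; rewrite !inE andbA.
Qed.

Lemma pos_rem A k j : k \in A -> pos A j = (k < j) + pos (A :\ k) j.
Proof. exact: card_sep. Qed.

Lemma cnt_rem A k s : k \in A -> cnt A s = (k <= s) + cnt (A :\ k) s.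
Proof. exact: card_sep. Qed.

Lemma pos_rem_self A k : pos (A :\ k) k = pos A k.
Proof.
by apply: eq_card => j; rewrite !inE; case: eqP => [->|]; rewrite ?ltnn ?andbF.
Qed.

Lemma pos_lt A j k : j \in A -> j < k -> pos A j < pos A k.
Proof.
move=> jA jk; rewrite (pos_rem k jA) jk -pos_rem_self ltnS.
apply: subset_leq_card; apply/subsetP => i; rewrite !inE => /andP[-> /=].
by move=> /ltn_trans; apply.
Qed.

Lemma pos_lt_cnt A k s : k \in A -> k <= s -> pos A k < cnt A s.
Proof.
move=> kA ks; rewrite (cnt_rem _ kA) ks -pos_rem_self ltnS.
apply: subset_leq_card; apply/subsetP => i; rewrite !inE => /andP[-> /=].
by move=> /ltnW/leq_trans; apply.
Qed.

Lemma cnt_le_pos A k s : s < k -> cnt A s <= pos A k.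
Proof.
move=> sk; apply: subset_leq_card; apply/subsetP => i; rewrite !inE => /andP[-> /=].
by move=> /leq_ltn_trans; apply.
Qed.

(** This is [m - k], written as a count of thresholds so that it merges with [cnt] under one sum. *)
Definition omega k : nat := \sum_(s < m) (k <= s).

(* Counting the elements up to each threshold [s] shows that this is the sum of
   [omega] over the [q] smallest elements of [A]. *)
Definition weight A q : nat := \sum_(s < m) minn q (cnt A s).

Lemma weight_rem A q k (e : bool) :
  e * omega k + weight (A :\ k) (q - e)
  = \sum_(s < m) (e * (k <= s) + minn (q - e) (cnt (A :\ k) s)).
Proof. by rewrite /omega big_distrr /= -big_split. Qed.

(** Makes the truncated subtraction in the exponent of [t] a true difference. *)
Lemma weight_le A q k (e : bool) : k \in A -> e <= q ->
  e * omega k + weight (A :\ k) (q - e) <= weight A q.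
Proof.
move=> kA eq; rewrite weight_rem; apply: leq_sum => s _; rewrite (cnt_rem _ kA).
by case: e eq; case: (k <= s) => /=; lia.
Qed.

(** No weight is lost if [k] takes an [a]-entry when it is among the [q] smallest elements and a
    [b]-entry otherwise; these terms survive at [t = 0]. *)
Lemma weight_lead A q k (e : bool) : k \in A -> e = (pos A k < q) ->
  e * omega k + weight (A :\ k) (q - e) = weight A q.
Proof.
move=> kA ->; rewrite weight_rem; apply: eq_bigr => s _.
have := @pos_lt_cnt A k s kA; have := @cnt_le_pos A k s; rewrite [s < k]ltnNge.
rewrite (cnt_rem _ kA); case: (leqP k s) => /= _ h1 h2.
  by have := h2 isT; case: ltnP => /=; lia.
by have := h1 isT; case: ltnP => /=; lia.
Qed.

Lemma weight_lt A q k (e : bool) : k \in A -> 0 < q -> e = ~~ (pos A k < q) ->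
  e * omega k + weight (A :\ k) (q - e) < weight A q.
Proof.
move=> kA q0 ee.
have [s hs] : exists s, e * (k <= s) + minn (q - e) (cnt (A :\ k) s) < minn q (cnt A s).
  move: ee; case: ltnP => /= [kq ->|qk ->].
    (* At the threshold [k] the removed element itself is counted, and the bound [q] is not yet
       reached without it. *)
    exists k; have : cnt A k <= (pos A k).+1.
      rewrite (cnt_rem _ kA) leqnn add1n ltnS -pos_rem_self.
      apply: subset_leq_card; apply/subsetP => i; rewrite !inE => /andP[/andP[ik ->]] /=.
      by move=> ile; rewrite ik /= ltn_neqAle ile andbT.
    by rewrite (cnt_rem _ kA) leqnn; lia.
  (* Now [q] elements lie below [k], so at the threshold [k - 1] the minimum falls from [q] to
     [q - 1], with no compensation from [omega k]. *)
  have k0 : 0 < k.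
    rewrite lt0n; apply: contraTneq (leq_trans q0 qk) => k0.
    rewrite -leqNgt leqn0 cards_eq0; apply/eqP/setP => j.
    by rewrite !inE k0 ltn0 andbF.
  have hk : k.-1 < m by apply: leq_ltn_trans (ltn_ord k); apply: leq_pred.
  exists (Ordinal hk).
  have : cnt A (Ordinal hk) = pos A k.
    by apply: eq_card => j; rewrite !inE /= -ltnS prednK.
  rewrite (cnt_rem _ kA) /= leqNgt prednK // leqnn /=; lia.
rewrite weight_rem /weight (bigD1 s) //= [X in _ < X](bigD1 s) //=.
rewrite -addSn leq_add //; apply: leq_sum => i _; rewrite (cnt_rem _ kA).
by move: ee; case: ltnP => + ->; case: (k <= i) => /=; lia.
Qed.

End Cells.

(** * The differential and its square *)

Section Differential.
Local Open Scope ring_scope.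
Variables (K : fieldType) (n m : nat).
Variables (kappa : 'I_n -> 'I_m) (par : 'I_n -> bool) (t : K).
Local Notation S := {mpoly K[n]}.
Local Notation mon := 'X_{1..n}.
Implicit Types (A B : {set 'I_m}) (k j : 'I_m).

(* [xv true k] and [xv false k] are the two entries [a_k], [b_k] of the [k]-th
   column of the matrix whose 2-minors generate the toric ideal. *)
Definition xv (e : bool) k : mon :=
  [multinom ((kappa i == k) && (par i == ~~ e) : nat) | i < n].

(* The exponent of [t] is the drop in [weight]: for [t = 1] these are the
   coefficients of the Eagon-Northcott complex, for [t = 0] only the part that
   preserves [weight] survives. *)
Definition dcoef (e : bool) q A k : K :=
  (-1) ^+ pos A k * t ^+ (weight A q - (e * omega k + weight (A :\ k) (q - e)))%N.

(** The entry from [(A, q)] to [(B, q - e)]. There is at most one summand; the sum form lets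
    products expand. *)
Definition dx (e : bool) q A B : S :=
  \sum_(k in A | A :\ k == B) dcoef e q A k *: 'X_[xv e k].

Lemma dx_sum e q A (F : {set 'I_m} -> S) :
  \sum_B dx e q A B * F B = \sum_(k in A) dcoef e q A k *: 'X_[xv e k] * F (A :\ k).
Proof.
rewrite /dx; under eq_bigr do rewrite mulr_suml.
rewrite (exchange_big_dep (fun k => k \in A)) /=; last by move=> B k _ /andP[].
apply: eq_bigr => k kA; rewrite (big_pred1 (A :\ k)) // => B.
by rewrite kA eq_sym.
Qed.

Lemma dx_rem e q A k : k \in A -> dx e q A (A :\ k) = dcoef e q A k *: 'X_[xv e k].
Proof.
move=> kA; rewrite /dx (big_pred1 k) // => j /=.
apply/andP/eqP => [[jA /eqP e1]|->]; last by rewrite eqxx.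
apply/eqP; apply: contraT => njk; have : j \in A :\ k by rewrite in_setD1 njk jA.
by rewrite -e1 setD11.
Qed.

(** The contribution of removing [k] with entry [e], then [j] with entry [h]. The exponents of [t]
    have telescoped, so only the sign depends on the order. *)
Definition dterm (e h : bool) q A B k j : S :=
  if [&& k \in A, j \in A, j != k & A :\ k :\ j == B] then
    ((-1) ^+ (pos A k + pos (A :\ k) j)
      * t ^+ (weight A q - (e * omega k + h * omega j + weight B (q - (e + h))))%N)
    *: 'X_[xv e k + xv h j]
  else 0.

Lemma dx_dx (e h : bool) q A B : (e + h <= q)%N ->
  \sum_C dx e q A C * dx h (q - e) C B = \sum_k \sum_j dterm e h q A B k j.
Proof.
move=> ehq; rewrite dx_sum [LHS]big_mkcond /=; apply: eq_bigr => k _.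
case: ifP => kA; last by rewrite big1 // => j _; rewrite /dterm kA.
rewrite /dx mulr_sumr [LHS]big_mkcond /=; apply: eq_bigr => j _.
rewrite /dterm kA in_setD1 /=; case: (eqVneq j k) => [//|njk /=]; first by rewrite !andbF.
case: (boolP (j \in A)) => jA //=; case: eqP => // <-.
rewrite -scalerAl -scalerAr scalerA mpolyXD /dcoef; congr (_ *: _).
rewrite mulrACA -!exprD; congr (_ ^+ _ * _ ^+ _).
have kj : j \in A :\ k by rewrite in_setD1 njk.
have eq : (e <= q)%N by lia.
have hq : (h <= q - e)%N by lia.
have := weight_le kA eq; have := weight_le kj hq; rewrite -!subnDA.
move: (weight A q) (weight (A :\ k) _) (weight (A :\ k :\ j) _) (e * _)%N (h * _)%N.
by clear; lia.
Qed.

Lemma dtermC e h q A B k j : dterm e h q A B k j = - dterm h e q A B j k.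
Proof.
rewrite /dterm [j == k]eq_sym.
have -> : A :\ j :\ k = A :\ k :\ j by apply/setP => i; rewrite !inE andbCA.
case: (boolP (k \in A)) => kA; case: (boolP (j \in A)) => jA; rewrite ?oppr0 //=.
case: (eqVneq k j) => [_|nkj]; rewrite ?oppr0 //=; case: eqP => _; rewrite ?oppr0 //.
rewrite -scaleNr [(xv h j + _)%MM]addmC -mulNr [(h * _ + _)%N]addnC [(h + e)%N]addnC.
congr (_ * _ *: _); rewrite (pos_rem k jA) (pos_rem j kA).
have : (j < k)%N != (k < j)%N by move: nkj; rewrite -(inj_eq val_inj) /=; lia.
rewrite !exprD; case: ltnP => _; case: ltnP => _ //= _.
all: by rewrite ?expr1 ?expr0 ?mul1r ?mulN1r ?mulrN ?mulNr ?opprK mulrC.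
Qed.

Lemma dx_dxC (e h : bool) q A B : (e + h <= q)%N ->
  \sum_C dx e q A C * dx h (q - e) C B = - \sum_C dx h q A C * dx e (q - h) C B.
Proof.
move=> ehq; have heq : (h + e <= q)%N by rewrite addnC.
rewrite (dx_dx _ _ ehq) (dx_dx _ _ heq) exchange_big /= -sumrN; apply: eq_bigr => k _.
by rewrite -sumrN; apply: eq_bigr => j _; apply: dtermC.
Qed.

Lemma dx_dx0 (e : bool) q A B : (e + e <= q)%N ->
  \sum_C dx e q A C * dx e (q - e) C B = 0.
Proof.
move=> eeq; rewrite dx_dx //; apply: sum_antisym => [k j|k]; first exact: dtermC.
by rewrite /dterm eqxx !andbF.
Qed.

Lemma mcoeff_sum_neq0 (T : finType) (P : pred T) (F : T -> S) u :
  (\sum_(i | P i) F i)@_u != 0 -> exists i, P i /\ (F i)@_u != 0.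
Proof.
move=> h; suff /existsP[i /andP[Pi Fi]] : [exists i, P i && ((F i)@_u != 0)] by exists i.
apply: contraNT h; rewrite negb_exists raddf_sum => /forallP h.
rewrite big1 // => i Pi; apply/eqP; have := h i.
by rewrite Pi negbK.
Qed.

Lemma dx_neq0 e q A B u : (dx e q A B)@_u != 0 ->
  exists k, [/\ k \in A, B = A :\ k & u = xv e k].
Proof.
move=> /mcoeff_sum_neq0[k [/andP[kA /eqP <-]]].
rewrite mcoeffZ mcoeffX; case: (xv e k =P u) => [<- _|_]; first by exists k.
by rewrite mulr0 eqxx.
Qed.

Lemma dx_card e q A B : #|A| != #|B|.+1 -> dx e q A B = 0.
Proof.
move=> ne; rewrite /dx big_pred0 // => k; apply/andP => -[kA /eqP eB].
by move: ne; rewrite -eB (cardsD1 k A) kA eqxx.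
Qed.

(* A cell [(A, q)] stands for the basis element of the Eagon-Northcott complex
   given by the columns in [A] and the [q - 1]-st of the [#|A| - 1] monomials of
   degree [#|A| - 2] in two variables; [(set0, 0)] is the basis of degree 0. *)
Definition cell : Type := ({set 'I_m} * 'I_m.+1)%type.

Definition valid_cell (c : cell) : bool :=
  ((c.1 == set0) && (c.2 == 0 :> nat)) || (0 < c.2 < #|c.1|)%N.

(** Into degree 0 this is a deformed minor: for columns [j < k] it equals
    [a_j b_k - t^(k - j) a_k b_j]. *)
Definition delta (c c' : cell) : S :=
  if c'.1 == set0 then \sum_B dx true 1 c.1 B * dx false 0 B set0
  else \sum_(e : bool | (c'.2 + e == c.2)%N) dx e c.2 c.1 c'.1.

(** Sizes 0 and 1 both have predecessor 0, but a set of size 1 carries no valid cell. *)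
Definition cells i : {set cell} := [set c | valid_cell c & (#|c.1|.-1 == i)%N].

Lemma cellsS i c : (c \in cells i.+1) = (#|c.1| == i.+2) && (0 < c.2 < i.+2)%N.
Proof.
rewrite inE /valid_cell -cards_eq0; case: #|c.1| => [|k] /=; first by rewrite andbF.
by rewrite eqSS andbC; case: (k =P i.+1) => [->|].
Qed.

Lemma cells0 c : c \in cells 0 -> c = (set0, ord0).
Proof.
rewrite inE /valid_cell; case: c => A q /= /andP[/orP[/andP[/eqP -> /eqP q0] _|h1 /eqP h2]].
  by congr (_, _); apply: val_inj.
by case: #|A| h1 h2 => [|[|k]] //; lia.
Qed.

Lemma delta_sum i c (F : cell -> S) : c \in cells i.+2 ->
  \sum_(c' in cells i.+1) delta c c' * F c' =
  \sum_(e : bool | (0 < c.2 - e < i.+2)%N)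
     \sum_B dx e c.2 c.1 B * F (B, inord (c.2 - e)).
Proof.
rewrite cellsS => /andP[/eqP cA /andP[c0 c2]].
transitivity (\sum_(c' in cells i.+1) \sum_(e : bool | (c'.2 + e == c.2)%N)
    dx e c.2 c.1 c'.1 * F c').
  apply: eq_bigr => c'; rewrite cellsS => /andP[/eqP cA' _].
  by rewrite /delta -cards_eq0 cA' /= mulr_suml.
rewrite (exchange_big_dep xpredT) //= [RHS]big_mkcond /=; apply: eq_bigr => e _.
case: ifP => he; last first.
  rewrite big_pred0 // => c'; rewrite cellsS; apply/negP => /andP[/andP[_ h1] /eqP h2].
  by move: he; rewrite -h2 addnK h1.
rewrite [RHS](bigID (fun B => #|B| == i.+2)) /= [X in _ = _ + X]big1 ?addr0; last first.
  by move=> B nB; rewrite dx_card ?mul0r // cA eqSS eq_sym.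
have ec : (e <= c.2)%N by case: (e) c0.
have em : (c.2 - e < m.+1)%N by apply: leq_ltn_trans (leq_subr _ _) (ltn_ord _).
rewrite (reindex_onto (fun B => (B, inord (c.2 - e)) : cell) fst) /=; last first.
  move=> [B q]; rewrite cellsS /= => /andP[_ /eqP h]; congr (_, _).
  by apply: val_inj; rewrite /= inordK // -h addnK.
by apply: eq_bigl => B; rewrite cellsS /= inordK // he subnK // !eqxx !andbT.
Qed.

Lemma delta_delta i c c'' : c \in cells i.+2 -> c'' \in cells i ->
  \sum_(c' in cells i.+1) delta c c' * delta c' c'' = 0.
Proof.
move=> hc; rewrite (delta_sum _ hc); case: c hc => A q; case: c'' => A'' q''.
rewrite cellsS /= => /andP[/eqP cA /andP[c0 c2]].
have qm (e : bool) : (inord (q - e) : 'I_m.+1) = (q - e)%N :> nat.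
  by rewrite inordK // (leq_ltn_trans (leq_subr _ _)).
case: i => [|i] in cA c2 *.
  move=> /cells0[-> ->]; rewrite /delta eqxx /= big1 // => e /andP[e0 e1].
  have eq1 : (q - e = 1)%N by apply/eqP; rewrite eqn_leq -ltnS e1 e0.
  under eq_bigr do rewrite mulr_sumr.
  rewrite exchange_big /=.
  under eq_bigr do under eq_bigr do rewrite mulrA.
  under eq_bigr do rewrite -mulr_suml.
  case: e {e0 e1} eq1 => eq1.
    (* Here [q = 2], and the two removals with [a]-entries cancel. *)
    rewrite big1 // => B _; have := @dx_dx0 true q A B; rewrite eq1 => ->.
      by rewrite mul0r.
    by lia.
  have {eq1} q1 : q = 1%N :> nat by rewrite -eq1 subn0.
  rewrite q1.
  (* Moving the removal with the [a]-entry to the front leaves two removals with [b]-entries, which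
     cancel. *)
  have dC B : \sum_C dx false 1 A C * dx true 1 C B
      = - \sum_C dx true 1 A C * dx false 0 C B by rewrite -(@dx_dxC false true 1).
  under eq_bigr do rewrite dC mulNr mulr_suml.
  rewrite sumrN exchange_big /= big1 ?oppr0 // => B _.
  under eq_bigr do rewrite -mulrA.
  rewrite -mulr_sumr; have := @dx_dx0 false 0 B set0 isT; rewrite subn0 => ->.
  by rewrite mulr0.
rewrite cellsS /= => /andP[/eqP cA'' /andP[c0'' c2'']].
(* For a given target either [e = h] is forced or both mixed orders occur; the former vanish, the
   latter cancel. *)
pose P (e h : bool) := \sum_B dx e q A B * dx h (q - e) B A''.
transitivity (\sum_(e : bool) \sum_(h : bool) if (q'' + (e + h) == q)%N then P e h else 0).
  rewrite big_mkcond /=; apply: eq_bigr => e _.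
  rewrite /delta -cards_eq0 cA'' /= -big_mkcond /= /P exchange_big /=.
  case: ifP => he; last first.
    rewrite big1 // => B _; rewrite big_pred0 // => h.
    apply/negP => /eqP hq; move/negP: he; apply.
    by rewrite -hq addnCA addKn; case: (h) => /=; lia.
  apply: eq_bigr => B _; rewrite mulr_sumr qm; apply: eq_bigl => h.
  by apply/eqP/eqP; lia.
have PP (e : bool) : (q'' + (e + e) == q)%N -> P e e = 0.
  by move=> /eqP h; rewrite /P dx_dx0 //; lia.
have PC : (q'' + 1 == q)%N -> P true false = - P false true.
  by move=> /eqP h; rewrite /P dx_dxC //; lia.
have PT := PP true; have := PP false; rewrite /= !addn0 => PF; rewrite !big_bool /= add0n !addn0.
case: ifP => [/PT ->|_]; case: ifP => [/PC ->|_]; case: ifP => [/PF ->|_].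
all: by rewrite ?addr0 ?add0r ?addNr.
Qed.

End Differential.
Lemma cards_rem (T : finType) (A : {set T}) x : x \in A -> #|A| = #|A :\ x|.+1.
Proof. by move=> xA; rewrite (cardsD1 x A) xA. Qed.

Lemma omega_lt m (j k : 'I_m) : j < k -> omega k < omega j.
Proof.
move=> jk; have kj : (k <= j) = false by rewrite leqNgt jk.
rewrite /omega (bigD1 j) //= [X in _ < X](bigD1 j) //= leqnn kj.
by rewrite add0n add1n ltnS; apply: leq_sum => s _; case: (leqP k s) => // ks;
  rewrite (leq_trans (ltnW jk) ks).
Qed.

Lemma mcoeffXM_neq0 (K : fieldType) n (x y : 'X_{1..n}) (p : {mpoly K[n]}) c :
  (((c *: 'X_[x]) * p)@_y != 0)%R -> exists z, y = (x + z)%MM /\ (p@_z != 0)%R.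
Proof.
rewrite -mcoeff_msupp => /msuppM_le/allpairsP[[x' z] [/= hx hz ->]].
exists z; rewrite -mcoeff_msupp; split=> //; congr (_ + _)%MM.
by move: hx => /msuppZ_le; rewrite msuppX inE => /eqP.
Qed.

(** * The matching *)

Section CellMatching.
Local Open Scope ring_scope.
Variables (K : fieldType) (n m : nat).
Variables (kappa : 'I_n -> 'I_m) (par : 'I_n -> bool) (t : K) (k0 : 'I_m).
Local Notation S := {mpoly K[n]}.
Local Notation mon := 'X_{1..n}.
Local Notation cell := (cell m).
Local Notation xv := (xv kappa par).
Local Notation dx := (dx kappa par t).
Local Notation delta := (delta kappa par t).
Implicit Types (A B : {set 'I_m}) (k j : 'I_m) (u v w : mon) (c : cell).

Variable wt : mon -> nat.
Hypothesis wtD : forall u v, wt (u + v)%MM = (wt u + wt v)%N.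
Hypothesis wt_xv : forall e k, wt (xv e k) = (e * omega k)%N.

(* The monomial of the multidegree in which the cell [(A, q)] lies when [t = 0]. *)
Definition mcell A q : mon :=
  [multinom ((kappa i \in A) && (par i == ~~ (pos A (kappa i) < q)%N) : nat) | i < n].

Lemma mcell_lead A q k (e : bool) : k \in A -> e = (pos A k < q)%N ->
  (xv e k + mcell (A :\ k) (q - e))%MM = mcell A q.
Proof.
move=> kA ee; apply/mnmP => i; rewrite mnmDE !mnmE in_setD1.
case: (eqVneq (kappa i) k) => [->|nk] /=; first by rewrite kA ee addn0.
rewrite add0n; case: (boolP (kappa i \in A)) => //= iA.
have -> : (pos (A :\ k) (kappa i) < q - e)%N = (pos A (kappa i) < q)%N; last by [].
have := pos_rem (kappa i) kA; have := @pos_lt _ A (kappa i) k iA.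
have := @pos_lt _ A k (kappa i) kA.
have : (kappa i < k)%N != (k < kappa i)%N by move: nk; rewrite -(inj_eq val_inj) /=; lia.
rewrite ee; case: (ltnP (kappa i) k) => _; case: (ltnP k (kappa i)) => _ //= _ h1 h2 h3.
  by have := h2 isT; case: (ltnP (pos A k)) => /=; lia.
by have := h1 isT; case: (ltnP (pos A k)) => /=; lia.
Qed.

Lemma mcell_set0 q : mcell set0 q = 0%MM.
Proof. by apply/mnmP => i; rewrite !mnmE in_set0. Qed.

(** [mcell A q] contains no variable of [xv e k], so this factor comes from [u]. *)
Lemma xv_le_cancel A q u k (e : bool) : (xv e k <= u + mcell A q)%MM ->
  (k \in A -> e != (pos A k < q)%N) -> (xv e k <= u)%MM.
Proof.
move=> /mnm_lepP h ne; apply/mnm_lepP => i; have := h i.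
rewrite mnmDE !mnmE; case: eqP => //= ->; case: eqP => //= ->.
case: (boolP (k \in A)) => [/ne|] /=; last by rewrite addn0.
by case: e {h ne}; case: (_ < _)%N => //=; rewrite addn0.
Qed.

Lemma xv_add_le w e k e' k' : (xv e k <= w)%MM -> (xv e' k' <= w)%MM ->
  k != k' -> (xv e k + xv e' k' <= w)%MM.
Proof.
move=> /mnm_lepP h /mnm_lepP h' ne; apply/mnm_lepP => i; have := h i; have := h' i.
rewrite mnmDE !mnmE; case: (kappa i =P k) => [->|_]; last by rewrite add0n.
by rewrite (negPf ne) addn0.
Qed.

(** The default is reached only if no [a]-entry divides [w], which does not occur for the
    multidegree of a cell with [0 < q < #|A|]. *)
Definition alpha w : 'I_m := odflt k0 [pick k | (xv true k <= w)%MM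
  && [forall j, (xv true j <= w)%MM ==> (k <= j)%N]].

Definition beta w : 'I_m := odflt k0 [pick k | (xv false k <= w)%MM
  && [forall j, (xv false j <= w)%MM ==> (j <= k)%N]].

Lemma alphaP w k : (xv true k <= w)%MM ->
  (xv true (alpha w) <= w)%MM /\ (alpha w <= k)%N.
Proof.
move=> hk; rewrite /alpha; case: pickP => [a /andP[-> /forallP/(_ k)]|/=].
  by rewrite hk.
case: (@arg_minnP _ k (fun j => (xv true j <= w)%MM) (fun j : 'I_m => j : nat) hk).
move=> a ha amin /(_ a); rewrite ha /= => /negP[].
by apply/forallP => j; apply/implyP; apply: amin.
Qed.

Lemma betaP w k : (xv false k <= w)%MM ->
  (xv false (beta w) <= w)%MM /\ (k <= beta w)%N.
Proof.
move=> hk; rewrite /beta; case: pickP => [a /andP[-> /forallP/(_ k)]|/=].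
  by rewrite hk.
case: (@arg_maxnP _ k (fun j => (xv false j <= w)%MM) (fun j : 'I_m => j : nat) hk).
move=> a ha amax /(_ a); rewrite ha /= => /negP[].
by apply/forallP => j; apply/implyP; apply: amax.
Qed.

Lemma pos_min A k : (forall j, j \in A -> (k <= j)%N) -> pos A k = 0%N.
Proof.
move=> h; apply/eqP; rewrite cards_eq0; apply/eqP/setP => j; rewrite !inE.
by apply/negP => /andP[/h]; rewrite leqNgt => /negP.
Qed.

Lemma pos_max A k : k \in A -> (forall j, j \in A -> (j <= k)%N) -> pos A k = #|A|.-1.
Proof.
move=> kA h; rewrite (cardsD1 k A) kA /=; apply: eq_card => j; rewrite !inE.
case: (boolP (j \in A)) => [/h jk|]; last by rewrite andbF.
by rewrite ltn_neqAle jk !andbT.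
Qed.

Lemma cell_le A q u k : k \in A -> (xv (pos A k < q)%N k <= u + mcell A q)%MM.
Proof.
move=> kA; rewrite -(mcell_lead kA (erefl _)) addmC -addmA.
exact: lem_addr.
Qed.

(** As [0 < q], the least element of [A] takes an [a]-entry and bounds [alpha] from above. Dually
    for [beta], as [q < #|A|]. *)
Lemma cell_alpha A q u : (0 < q < #|A|)%N -> let a := alpha (u + mcell A q)%MM in
  (xv true a <= u + mcell A q)%MM /\ (forall j, j \in A -> (a <= j)%N).
Proof.
move=> /andP[q0 qA] a; have /card_gt0P[j jA] := leq_ltn_trans (leq0n q) qA.
case: (@arg_minnP _ j (fun j => j \in A) (fun j : 'I_m => j : nat) jA) => i iA imin.
have := cell_le q u iA; rewrite (pos_min imin) q0 => /alphaP[h1 h2]; split=> // l lA.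
exact: leq_trans h2 (imin _ lA).
Qed.

Lemma cell_beta A q u : (0 < q < #|A|)%N -> let b := beta (u + mcell A q)%MM in
  (xv false b <= u + mcell A q)%MM /\ (forall j, j \in A -> (j <= b)%N).
Proof.
move=> /andP[q0 qA] b; have /card_gt0P[j jA] := leq_ltn_trans (leq0n q) qA.
case: (@arg_maxnP _ j (fun j => j \in A) (fun j : 'I_m => j : nat) jA) => i iA imax.
have := cell_le q u iA; rewrite (pos_max iA imax) ltnNge.
have -> : (q <= #|A|.-1)%N by lia.
move=> /betaP[h1 h2]; split=> // l lA; exact: leq_trans (imax _ lA) h2.
Qed.

Lemma cell_alpha_neq_beta A q u : (0 < q < #|A|)%N ->
  let a := alpha (u + mcell A q)%MM in let b := beta (u + mcell A q)%MM in
  a \in A -> b \in A -> b != a.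
Proof.
move=> hq /= aA bA; have [_ /pos_min pa] := cell_alpha u hq.
have [_ /(pos_max bA) pb] := cell_beta u hq.
apply: contraTneq hq => ab; rewrite ab pa in pb; lia.
Qed.

(* The matching toggles the least column [alpha] of the multidegree with an
   [a]-entry, then the greatest column [beta] with a [b]-entry. *)
Definition matched u c v c' : Prop :=
  let w := (u + mcell c.1 c.2)%MM in let a := alpha w in let b := beta w in
  [/\ (0 < c.2 < #|c.1|)%N, a \in c.1 &
   [\/ [/\ (1 < c.2)%N, c'.1 = c.1 :\ a, (c'.2 = c.2 - 1 :> nat)%N & v = (u + xv true a)%MM],
       [/\ (c.2 = 1 :> nat)%N /\ b \in c.1, (2 < #|c.1|)%N, c'.1 = c.1 :\ b,
           (c'.2 = 1 :> nat)%N & v = (u + xv false b)%MM]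
     | [/\ (c.2 = 1 :> nat)%N /\ b \in c.1, #|c.1| = 2, c' = (set0, ord0)
           & v = (u + (xv true a + xv false b))%MM]]].

Definition level u c : nat := (wt u + weight c.1 c.2)%N.

Definition rank u c : nat :=
  let w := (u + mcell c.1 c.2)%MM in
  if alpha w \notin c.1 then 2 else ((c.2 == 1 :> nat)%N && (beta w \notin c.1) : nat).

(* Terms of the differential that are absent for [t = 0] lower [level]; among
   the others the matched term is the only one of maximal [rank]. *)
Definition mu u c : nat := (3 * level u c + rank u c)%N.

Lemma weight0 q : weight (set0 : {set 'I_m}) q = 0%N.
Proof.
rewrite /weight big1 // => s _; rewrite (_ : cnt _ _ = 0%N) ?minn0 //.
by apply/eqP; rewrite cards_eq0; apply/eqP/setP => j; rewrite !inE.
Qed.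

Lemma step_lead u A q k (e : bool) q' : k \in A -> e = (pos A k < q)%N -> q' = (q - e)%N ->
  (u + xv e k + mcell (A :\ k) q')%MM = (u + mcell A q)%MM /\
  (wt (u + xv e k) + weight (A :\ k) q')%N = (wt u + weight A q)%N.
Proof.
move=> kA ee ->; rewrite -addmA (mcell_lead kA ee) wtD wt_xv -addnA.
by rewrite (weight_lead kA ee).
Qed.

(** Partners therefore share [alpha] and [beta], which makes the removed column recoverable from the
    target. *)
Lemma matched_level u c v c' : matched u c v c' ->
  (v + mcell c'.1 c'.2)%MM = (u + mcell c.1 c.2)%MM /\ level v c' = level u c.
Proof.
case: c => A q; case: c' => A' q' [] /= hq; rewrite /level /=.
set w := (u + _)%MM; have [a_le a_min] := cell_alpha u hq.
have [b_le b_max] := cell_beta u hq; rewrite -/w in a_le a_min b_le b_max * => aA.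
have pa := pos_min a_min.
case=> [[q1 -> hq' ->]|[[q1 bA] A2 -> hq' ->]|[[q1 bA] A2 [-> ->] ->]].
- by apply: step_lead => //; rewrite pa; lia.
- apply: step_lead => //; last by rewrite hq' q1.
  apply/esym/negbTE; rewrite -leqNgt (pos_max bA b_max) q1 -subn1 subn_gt0.
  exact: ltnW.
- have pb := pos_max bA b_max.
  have nab : beta w != alpha w := cell_alpha_neq_beta hq aA bA.
  have bAa : beta w \in A :\ alpha w by rewrite in_setD1 nab.
  have A0 : A :\ alpha w :\ beta w = set0.
    apply/eqP; rewrite -cards_eq0; have := A2.
    by rewrite (cards_rem aA) (cards_rem bAa) => -[->].
  have e1 : true = (pos A (alpha w) < q)%N by rewrite pa q1.
  have [h1 h2] := step_lead u aA e1 (erefl (q - true)%N).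
  have e2 : false = (pos (A :\ alpha w) (beta w) < q - true)%N by rewrite q1.
  have [h3 h4] := step_lead (u + xv true (alpha w)) bAa e2 (erefl _).
  rewrite A0 in h3 h4; rewrite !mcell_set0 !weight0 in h3 h4 *.
  by rewrite addmA h3 h1 h4 h2.
Qed.

Lemma matched_inj u c u' c' v c'' : matched u c v c'' -> matched u' c' v c'' ->
  (u, c) = (u', c').
Proof.
move=> hm hm'; have [w1 _] := matched_level hm; have [w2 _] := matched_level hm'.
suff cc : c = c'.
  rewrite cc; congr (_, _); apply: (@addIm _ (mcell c'.1 c'.2)).
  by rewrite -w2 w1 cc.
have ne (x : mon) (d : cell) := @cell_alpha_neq_beta d.1 d.2 x.
move: (ne u c) (ne u' c') hm hm'; rewrite /matched -w1 -w2.
set w := (v + _)%MM.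
case: c {w1} => A q; case: c' {w2} => A' q'; case: c'' w => B r w /=.
have card1 (D : {set 'I_m}) x : x \in D -> (1 < #|D|)%N -> D :\ x = set0 -> False.
  by move=> xD + /eqP; rewrite -cards_eq0 (cards_rem xD) ltnS lt0n => /negP.
move=> ab ab' [hq aA h] [hq' aA' h'].
have {ab} ab := ab hq aA; have {ab'} ab' := ab' hq' aA'.
have /andP[q0 qA] := hq; have /andP[q0' qA'] := hq'.
(* The three alternatives have disjoint targets: column sets without [alpha], with [alpha], and
   empty; the first two are never empty. *)
case: h => [[q1 eB eq _]|[[q1 bA] A2 eB _ _]|[[q1 bA] A2 [eB _] _]];
  case: h' => [[q1' eB' eq' _]|[[q1' bA'] A2' eB' _ _]|[[q1' bA'] A2' [eB' _] _]].
all: try (have qq : q = q' by apply: val_inj => /=; lia).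
- by rewrite qq -(setD1K aA) -(setD1K aA') -eB -eB'.
- have : alpha w \in B by rewrite eB' in_setD1 aA' andbT eq_sym ab'.
  by rewrite eB setD11.
- by case: (card1 A _ aA (ltn_trans q1 qA) (etrans (esym eB) eB')).
- have : alpha w \in B by rewrite eB in_setD1 aA andbT eq_sym ab.
  by rewrite eB' setD11.
- by rewrite qq -(setD1K bA) -(setD1K bA') -eB -eB'.
- by case: (card1 A _ bA (ltnW A2) (etrans (esym eB) eB')).
- by case: (card1 A' _ aA' (ltn_trans q1' qA') (etrans (esym eB') eB)).
- by case: (card1 A' _ bA' (ltnW A2') (etrans (esym eB') eB)).
- rewrite qq; congr (_, _).
  have E (D : {set 'I_m}) : alpha w \in D -> beta w \in D -> beta w != alpha w ->
      #|D| = 2 -> D = [set alpha w; beta w].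
    move=> aD bD nab D2; apply/esym/eqP; rewrite eqEcard cards2 eq_sym nab D2 andbT.
    by apply/subsetP => x; rewrite !inE => /orP[]/eqP->.
  exact: etrans (E _ aA bA (ab bA) A2) (esym (E _ aA' bA' (ab' bA') A2')).
Qed.

(** By [weight_lead] the exponent of [t] is 0, so the coefficient is a sign even for [t = 0]. *)
Lemma matched_coef u c v c' : matched u c v c' -> ('X_[u] * delta c c')@_v != 0.
Proof.
case: c => A q; case: c' => A' q' [] /= hq.
set w := (u + _)%MM => aA; have /andP[q0 qA] := hq.
have [a_le a_min] := cell_alpha u hq; have pa := pos_min a_min.
have [b_le b_max] := cell_beta u hq; rewrite -/w in a_le a_min b_le b_max pa *.
have coef_neq0 (e : bool) r (D : {set 'I_m}) k : k \in D -> e = (pos D k < r)%N ->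
    dcoef t e r D k != 0.
  move=> kD ee; rewrite /dcoef (weight_lead kD ee) subnn expr0 mulr1.
  by rewrite signr_eq0.
have card1 (D : {set 'I_m}) x : x \in D -> (1 < #|D|)%N -> (D :\ x == set0) = false.
  by move=> xD; rewrite -cards_eq0 (cards_rem xD) ltnS lt0n => /negbTE.
have coefX (p : S) x : ('X_[u] * p)@_(u + x)%MM = p@_x by rewrite mulrC mcoeffMX.
case=> [[q1 -> hq' ->]|[[q1 bA] A2 -> hq' ->]|[[q1 bA] A2 [-> ->] ->]]; rewrite coefX.
- rewrite /delta /= (card1 _ _ aA (ltn_trans q1 qA)).
  rewrite (big_pred1 true) => [|e]; last by rewrite hq'; move: q1; case: e => /=; lia.
  by rewrite dx_rem // mcoeffZ mcoeffX eqxx mulr1 coef_neq0 // pa q0.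
- rewrite /delta /= (card1 _ _ bA (ltnW A2)).
  rewrite (big_pred1 false) => [|e]; last by rewrite hq' q1; case: e.
  rewrite dx_rem // mcoeffZ mcoeffX eqxx mulr1 coef_neq0 //.
  apply/esym/negbTE; rewrite -leqNgt (pos_max bA b_max) q1 -subn1 subn_gt0.
  exact: ltnW.
- rewrite /delta eqxx /= dx_sum (bigD1 (alpha w)) //=.
  have nab : beta w != alpha w := cell_alpha_neq_beta hq aA bA.
  have bAa : beta w \in A :\ alpha w by rewrite in_setD1 nab.
  have A0 : A :\ alpha w :\ beta w = set0.
    apply/eqP; rewrite -cards_eq0; have := A2.
    by rewrite (cards_rem aA) (cards_rem bAa) => -[->].
  rewrite -{1}A0 dx_rem // -scalerAl -scalerAr scalerA -mpolyXD.
  rewrite mcoeffD mcoeffZ mcoeffX eqxx mulr1 raddf_sum big1 /= ?addr0.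
    by rewrite mulf_neq0 // coef_neq0 // pa.
  (* A product [a_k b_j] with [k] beyond [alpha] has smaller weight, hence is another monomial. *)
  move=> k /andP[kA nka]; apply/eqP; apply: contraT => /mcoeffXM_neq0[z [hz]].
  move=> /dx_neq0[j [_ _ ez]]; have := congr1 wt hz; rewrite ez !wtD !wt_xv !mul0n !mul1n.
  have : (alpha w < k)%N by rewrite ltn_neqAle a_min // eq_sym nka.
  by move=> /omega_lt; lia.
Qed.

Lemma delta_neq0 c c' z : c'.1 != set0 -> (delta c c')@_z != 0 ->
  exists k (e : bool), [/\ k \in c.1, c'.1 = c.1 :\ k, (c'.2 + e = c.2)%N & z = xv e k].
Proof.
move=> /negPf ne; rewrite /delta ne => /mcoeff_sum_neq0[e [/eqP he /dx_neq0[k [h1 h2 h3]]]].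
by exists k, e.
Qed.

Lemma delta_set0_neq0 c q z : (delta c (set0, q))@_z != 0 ->
  exists k j, [/\ k \in c.1, j \in c.1 :\ k, c.1 :\ k :\ j = set0,
    z = (xv true k + xv false j)%MM & dcoef t true 1 c.1 k != 0].
Proof.
rewrite /delta eqxx dx_sum => /mcoeff_sum_neq0[k [kA]] h.
have kne : dcoef t true 1 c.1 k != 0.
  by apply: contraNneq h => ->; rewrite scale0r mul0r mcoeff0.
move: h => /mcoeffXM_neq0[z' [-> /dx_neq0[j [jA h ->]]]].
by exists k, j.
Qed.

Lemma rank_le2 u c : (rank u c <= 2)%N.
Proof. by rewrite /rank; case: ifP => // _; case: (_ && _). Qed.

(** A wrong entry loses weight. A right one keeps the multidegree, and unless it is the matched one
    its cell retains the column that the matching removes, so its rank is smaller. *)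
Lemma matched_lt i u c v c' v' c'' : c \in cells m i.+1 -> c'' \in cells m i ->
  matched u c v c' -> ('X_[u] * delta c c'')@_v' != 0 -> (v', c'') <> (v, c') ->
  (mu v' c'' < mu v c')%N.
Proof.
move=> hc hc'' hm; rewrite -['X_[u]]scale1r => /mcoeffXM_neq0[z [-> hz]] ne.
have [wE lE] := matched_level hm; case: hm.
case: c hc wE lE hz => A q; rewrite cellsS /= => /andP[/eqP cA _] wE lE hz hq.
rewrite /mu /rank wE; set w := (u + mcell A q)%MM => aA h.
have [_ a_min] := cell_alpha u hq; have pa := pos_min a_min.
have [_ b_max] := cell_beta u hq; rewrite -/w in a_min b_max pa *.
have nab : beta w \in A -> beta w != alpha w := cell_alpha_neq_beta hq aA.
have /andP[q0 qA] := hq.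
(* A rank is at most 2, so the factor 3 lets the level decide first. *)
have low r : (level (u + z)%MM c'' < level v c')%N ->
    (3 * level (u + z)%MM c'' + rank (u + z)%MM c'' < 3 * level v c' + r)%N.
  by have := rank_le2 (u + z)%MM c''; lia.
rewrite -/(rank (u + z)%MM c'').
have [c0|c0] := eqVneq c''.1 set0.
  have i0 : i = 0%N by move: hc''; rewrite inE c0 cards0 => /andP[_ /eqP].
  rewrite i0 in cA hc''; have c''E := cells0 hc''; rewrite {}c''E in hz ne low *.
  case: h => [[q1 _ _ _]|[_ A2 _ _ _]|[[q1 bA] A2 c'E vE]].
  - by rewrite cA ltnNge q1 in qA.
  - by rewrite cA in A2.
  apply: low; have [k [j [/= kA jA A0 zE _]]] := delta_set0_neq0 hz.
  rewrite c'E vE zE in ne *; rewrite /level /= !weight0 !addn0 !wtD !wt_xv !mul1n !mul0n.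
  rewrite !addn0 ltn_add2l; apply: omega_lt; rewrite ltn_neqAle a_min // andbT.
  apply/negP => /eqP/val_inj ak; case: ne; rewrite -ak; congr ((_ + (_ + xv _ _))%MM, _).
  apply/eqP; apply: contraT => njb.
  have : beta w \in A :\ k :\ j by rewrite !in_setD1 eq_sym njb -ak nab.
  by rewrite A0 in_set0.
have [k [e [/= kA c''1 c''2 zE]]] := delta_neq0 c0 hz.
have c''2' : c''.2 = (q - e)%N :> nat by rewrite -c''2 addnK.
have [ee|/eqP ee] := e =P (pos A k < q)%N; last first.
  apply: low; rewrite lE /level /= c''1 c''2' zE wtD wt_xv -addnA ltn_add2l.
  by apply: weight_lt => //; case: e ee {c''2 c''2' zE}; case: (_ < _)%N.
have [h1 h2] := step_lead u kA ee c''2'.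
rewrite lE /rank /level /= c''1 zE h1 h2 -/w ltn_add2l.
have cellE : c''.1 = c'.1 -> c''.2 = c'.2 :> nat -> c'' = c'.
  by case: (c'') (c') => B r [B' r'] /= -> /val_inj ->.
case: h => [[q1 c'1 c'2 vE]|[[q1 bA] A2 c'1 c'2 vE]|[_ A2 _ _]].
- rewrite c'1 setD11 /= in_setD1 aA andbT negbK; case: eqP => [ak|_]; last by case: (_ && _).
  move: ee; rewrite -ak pa q0 => ee; case: ne; rewrite zE vE -ak ee; congr (_, _).
  by apply: cellE; rewrite ?c'1 ?c''1 ?ak // c''2' c'2 ee.
- have c''0 : (0 < c''.2)%N.
    by move: hc''; rewrite inE /valid_cell (negPf c0) /= => /andP[/andP[]].
  (* With [e = true] the target would have second component 0. *)
  have e0 : e = false by case: e {zE ee c''2' h1 h2} c''2 => //; rewrite q1; lia.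
  have nka : alpha w != k by apply/eqP => ak; move: ee; rewrite -ak pa q0 e0.
  rewrite c'1 c'2 setD11 !in_setD1 aA bA (eq_sym (alpha w) (beta w)) nab // nka /=.
  case: (beta w =P k) => [bk|_] /=; last by rewrite andbF.
  case: ne; rewrite zE vE -bk e0; congr (_, _).
  by apply: cellE; rewrite ?c'1 ?c''1 ?bk // c''2' c'2 e0 q1.
- have i0 : i = 0%N by move: cA; rewrite A2 => -[<-].
  by rewrite i0 in hc''; rewrite (cells0 hc'') eqxx in c0.
Qed.

Lemma matched_cover i c u : c \in cells m i.+1 ->
  (exists v c', matched u c v c' /\ c' \in cells m i) \/
  (exists u' c', matched u' c' u c /\ c' \in cells m i.+2).
Proof.
case: c => A q; rewrite cellsS /= => /andP[/eqP cA /andP[q0 qA]].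
have hq : (0 < q < #|A|)%N by rewrite q0 cA.
set w := (u + mcell A q)%MM.
have [a_le a_min] := cell_alpha u hq; have [b_le b_max] := cell_beta u hq.
rewrite -/w in a_le a_min b_le b_max.
have [aA|naA] := boolP (alpha w \in A); last first.
  (* The new column is the least and takes an [a]-entry, so [q] grows by 1. *)
  right; pose A' := alpha w |: A.
  have aA' : alpha w \in A' := setU11 _ _.
  have A'a : A' :\ alpha w = A := setU1K naA.
  have le : (xv true (alpha w) <= u)%MM.
    by apply: (xv_le_cancel a_le) => aA; rewrite aA in naA.
  have A'm : #|A'| = i.+3 by rewrite (cards_rem aA') A'a cA.
  have q'm : (q.+1 < m.+1)%N.
    have := max_card A'; rewrite A'm card_ord => im.
    exact: leq_trans (leqW im).
  exists (u - xv true (alpha w))%MM, (A', Ordinal q'm); split; last first.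
    by rewrite cellsS /= A'm eqxx.
  have wE : (u - xv true (alpha w) + mcell A' q.+1)%MM = w.
    have := @mcell_lead A' q.+1 (alpha w) true aA'; rewrite A'a subn1 => <-.
      by rewrite addmA submK.
    rewrite pos_min // => j; rewrite in_setU1 => /predU1P[->//|]; exact: a_min.
  rewrite /matched /= wE A'm; split=> //; apply: Or31; split=> //.
  - by rewrite subn1.
  - by rewrite submK.
have [q1|q1] := ltnP 1 q.
  left; have hq' : (q.-1 < m.+1)%N by apply: leq_ltn_trans (leq_pred _) (ltn_ord q).
  exists (u + xv true (alpha w))%MM, (A :\ alpha w, Ordinal hq'); split.
    rewrite /matched /= -/w; split=> //; apply: Or31; split=> //=.
    by rewrite subn1.
  have := cA; rewrite (cards_rem aA) => -[cA']; rewrite inE /valid_cell /= cA' /= eqxx.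
  by rewrite andbT; apply/orP; right; move: q1 qA; lia.
have {q1} q1 : q = 1%N :> nat by apply/eqP; rewrite eqn_leq q1 q0.
have [bA|nbA] := boolP (beta w \in A).
  left; have [A2|A2] := ltnP 2 #|A|; last first.
    exists (u + (xv true (alpha w) + xv false (beta w)))%MM, (set0, ord0); split.
      rewrite /matched /= -/w; split=> //; apply: Or33; split=> //.
      by move: A2; rewrite cA; lia.
    move: A2; rewrite cA !ltnS leqn0 => /eqP ->.
    by rewrite inE /valid_cell /= eqxx cards0.
  exists (u + xv false (beta w))%MM, (A :\ beta w, q); split.
    by rewrite /matched /= -/w; split=> //; apply: Or32; split.
  have := cA; rewrite (cards_rem bA) => -[cA']; rewrite inE /valid_cell /= cA' /= eqxx.
  by rewrite andbT q1; apply/orP; right; move: A2; rewrite cA; lia.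
(* The new column is the greatest and takes a [b]-entry, so [q] stays 1. *)
right; pose A' := beta w |: A.
have bA' : beta w \in A' := setU11 _ _.
have A'b : A' :\ beta w = A := setU1K nbA.
have le : (xv false (beta w) <= u)%MM.
  by apply: (xv_le_cancel b_le) => bA; rewrite bA in nbA.
have A'm : #|A'| = i.+3 by rewrite (cards_rem bA') A'b cA.
exists (u - xv false (beta w))%MM, (A', q); split; last first.
  by rewrite cellsS /= A'm eqxx q1.
have wE : (u - xv false (beta w) + mcell A' q)%MM = w.
  have := @mcell_lead A' q (beta w) false bA'; rewrite A'b subn0 => <-.
    by rewrite addmA submK.
  rewrite (@pos_max A') // => [|j]; first by rewrite A'm q1.
  rewrite in_setU1 => /predU1P[->//|]; exact: b_max.
rewrite /matched /= wE A'm; split; first by rewrite q1.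
  by rewrite in_setU1 aA orbT.
by apply: Or32; split=> //; rewrite submK.
Qed.

(** These turn out to be the monomials outside the initial ideal. *)
Definition standard w : Prop :=
  forall j k, (xv true j <= w)%MM -> (xv false k <= w)%MM -> (k <= j)%N.

Lemma matched_cover0 w : ~ standard w ->
  exists u c, matched u c w (set0, ord0) /\ c \in cells m 1.
Proof.
move=> nst.
have [j [k [hj hk jk]]] : exists j k,
    [/\ (xv true j <= w)%MM, (xv false k <= w)%MM & (j < k)%N].
  apply: NNPP => nex; apply: nst => j k hj hk; rewrite leqNgt; apply/negP => jk.
  by apply: nex; exists j, k.
have [a_le aj] := alphaP hj; have [b_le kb] := betaP hk.
set a := alpha w in a_le aj; set b := beta w in b_le kb.
have ab : (a < b)%N by apply: leq_trans kb; apply: leq_ltn_trans jk.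
have nab : a != b by apply: contraTneq ab => ->; rewrite ltnn.
have bU : b \in [set a; b] :\ a by rewrite !inE eq_sym nab eqxx orbT.
have q1m : (1 < m.+1)%N by have := ltn_ord a; lia.
pose A := [set a; b]; pose u := (w - (xv true a + xv false b))%MM.
have wE : (u + mcell A 1)%MM = w.
  have aA : a \in A by rewrite set21.
  have AE : A :\ a :\ b = set0.
    by apply/setP => x; rewrite !inE; do 2!case: eqP.
  have pa : pos A a = 0%N.
    by apply: pos_min => x; rewrite !inE => /orP[]/eqP-> //; apply: ltnW.
  have := @mcell_lead A 1 a true aA; rewrite pa => /(_ (erefl _)) <-.
  have := @mcell_lead (A :\ a) (1 - true) b false bU.
  rewrite AE mcell_set0 => /(_ (erefl _)) <-; rewrite addm0 submK //.
  exact: xv_add_le.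
exists u, (A, Ordinal q1m); split; last by rewrite cellsS /= cards2 nab.
rewrite /matched /= wE -/a -/b cards2 nab; split=> //; first by rewrite set21.
apply: Or33; split=> //; first by rewrite set22.
rewrite submK //; exact: xv_add_le.
Qed.

End CellMatching.

(** * The resolutions and their Betti numbers *)

Section Resolution.
Local Open Scope ring_scope.
Variables (K : fieldType) (n m : nat).
Variables (kappa : 'I_n -> 'I_m) (par : 'I_n -> bool) (t : K) (k0 : 'I_m).
Local Notation S := {mpoly K[n]}.
Local Notation xv := (xv kappa par).
Local Notation delta := (delta kappa par t).
Local Notation matched := (matched kappa par k0).
Local Notation cells := (cells m).

Variable wt : 'X_{1..n} -> nat.
Hypothesis wtD : forall u v, wt (u + v)%MM = (wt u + wt v)%N.
Hypothesis wt_xv : forall e k, wt (xv e k) = (e * omega k)%N.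
Variable l : 'I_m -> nat.
Hypothesis mdeg_xv : forall e k, mdeg (xv e k) = l k.
Hypothesis l_gt0 : forall k, (0 < l k)%N.

Definition cell_deg (c : cell m) : nat := \sum_(k in c.1) l k.

Definition en_diff i : 'M[S]_(#|cells i.+1|, #|cells i|) :=
  \matrix_(a, b) delta (enum_val a) (enum_val b).

Definition en_deg i (a : 'I_#|cells i|) : nat := cell_deg (enum_val a).

Lemma set0_cell : (set0, ord0) \in cells 0.
Proof. by rewrite inE /valid_cell /= eqxx cards0. Qed.

Lemma cell0_val (b : 'I_#|cells 0|) : enum_val b = (set0, ord0).
Proof. exact: (cells0 (enum_valP b)). Qed.

Definition base_index : 'I_#|cells 0| := enum_rank_in set0_cell (set0, ord0).

Lemma cell0_index b : b = base_index.
Proof. by apply: enum_val_inj; rewrite !cell0_val. Qed.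

Lemma en_diff2 i : en_diff i.+1 *m en_diff i = 0.
Proof.
apply/matrixP => a b; rewrite !mxE.
under eq_bigr do rewrite !mxE.
rewrite -(big_enum_val (fun c => delta (enum_val a) c * delta c (enum_val b))).
by rewrite delta_delta // enum_valP.
Qed.

Lemma en_leads i u (a : 'I_#|cells i.+1|) v (b : 'I_#|cells i|) :
  matched u (enum_val a) v (enum_val b) ->
  leads (en_diff i) (fun v b => mu kappa par k0 wt v (enum_val b)) u a v b.
Proof.
move=> h; split=> [|v' b']; rewrite mxE; first exact: matched_coef wtD wt_xv _ _ _ _ h.
move=> hne ne; apply: (matched_lt wtD wt_xv (enum_valP a) (enum_valP b') h hne).
by move=> [ev /enum_val_inj eb]; apply: ne; rewrite ev eb.
Qed.

Lemma en_exact i (z : 'rV[S]_#|cells i.+1|) : z *m en_diff i = 0 ->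
  exists w, z = w *m en_diff i.+1.
Proof.
apply: (matching_exact (en_diff2 i) (@en_leads i.+1) (@en_leads i)).
  move=> u a u' a' v b h h'.
  by have [-> /enum_val_inj ->] := matched_inj wtD wt_xv h h'.
move=> u a; have [[v [c [h hc]]]|[v [c [h hc]]]] := matched_cover kappa par k0 u (enum_valP a).
  by left; exists v, (enum_rank_in hc c); rewrite enum_rankK_in.
by right; exists v, (enum_rank_in hc c); rewrite enum_rankK_in.
Qed.

(** A normal form modulo the image of [en_diff 0], used to identify that image with an ideal. *)
Lemma en_reduce (p : S) : exists w : 'rV[S]_#|cells 1|, forall v,
  v \in msupp (p - (w *m en_diff 0) 0 base_index) -> standard kappa par v.
Proof.
pose D v (b : 'I_#|cells 0|) := exists u (a : 'I_#|cells 1|), matched u (enum_val a) v (enum_val b).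
have hD v b : D v b -> exists u a,
    leads (en_diff 0) (fun v b => mu kappa par k0 wt v (enum_val b)) u a v b.
  by move=> [u [a h]]; exists u, a; apply: en_leads.
have [w hw] := matching_reduce hD (const_mx p).
exists w => v; rewrite mcoeff_msupp => hv; apply: NNPP => nst.
have [u [c [h hc]]] := matched_cover0 k0 nst.
case/negP: hv; apply/eqP; rewrite -[RHS](hw v base_index).
  by rewrite !mxE.
by exists u, (enum_rank_in hc c); rewrite enum_rankK_in // cell0_val.
Qed.

Lemma en_graded i : mxgraded (@en_deg i.+1) (@en_deg i) (en_diff i).
Proof.
move=> a b u; rewrite mcoeff_msupp mxE /en_deg /cell_deg.
have := enum_valP a; have := enum_valP b.
case: (enum_val a) => A q; case: (enum_val b) => B r.
have [->|B0] := eqVneq B set0 => _ _ /=.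
  move=> /delta_set0_neq0[k [j [/= kA jA A0 -> _]]].
  rewrite big_set0 addn0 mdegD !mdeg_xv (big_setD1 k) //= (big_setD1 j) //= A0.
  by rewrite big_set0 addn0.
move=> /(delta_neq0 (c' := (B, r)) B0)[k [e [/= kA -> _ ->]]].
by rewrite mdeg_xv [RHS](big_setD1 k).
Qed.

(** A constant term would join basis elements of equal degree, but every removed column lowers the
    degree by [l k > 0]. *)
Lemma en_minimal i : map_mx (fun p : S => p@_0%MM) (en_diff i) = 0.
Proof.
apply/matrixP => a b; rewrite mxE [RHS]mxE; apply/eqP; apply: contraT.
rewrite -mcoeff_msupp => h; have := en_graded h; move: h.
rewrite mcoeff_msupp mxE /en_deg /cell_deg mdeg0 add0n.
case: (enum_val a) => A q; case: (enum_val b) => B r /=.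
have [->|B0] := eqVneq B set0.
  move=> /delta_set0_neq0[k [j [/= kA _ _ _ _]]].
  by rewrite big_set0 (big_setD1 k) //=; have := l_gt0 k; lia.
move=> /(delta_neq0 (c' := (B, r)) B0)[k [e [/= kA -> _ _]]].
rewrite [X in _ = X](big_setD1 k) //= => /eqP; rewrite -[X in X == _]add0n eqn_add2r.
by rewrite eq_sym (gtn_eqF (l_gt0 k)).
Qed.

Definition quot_complex : gfree_complex K n :=
  @GFreeComplex K n (fun i => #|cells i|) en_deg en_diff (const_mx 1).

(** The resolution of the quotient without its degree 0 module, so homological degrees shift by
    one. *)
Definition ideal_complex : gfree_complex K n :=
  @GFreeComplex K n (fun i => #|cells i.+1|) (fun i => @en_deg i.+1)
    (fun i => en_diff i.+1) (en_diff 0 *m const_mx 1).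

(** Instantiated with the toric ideal for [t = 1] and its initial ideal for [t = 0]. *)
Variable I : S -> Prop.
Hypothesis IE : forall p, I p <->
  exists w : 'rV[S]_#|cells 1|, p = (w *m en_diff 0) 0 base_index.

Lemma mul_const1 (v : 'rV[S]_#|cells 0|) : (v *m const_mx 1 : 'M_1) 0 0 = v 0 base_index.
Proof.
rewrite mxE (bigD1 base_index) //= big1 => [|b]; last by rewrite [b]cell0_index eqxx.
by rewrite mxE mulr1 addr0.
Qed.

Lemma en_ideal_closed : ideal_closed I.
Proof.
split.
- by apply/IE; exists 0; rewrite mul0mx mxE.
- move=> p q /IE[w ->] /IE[w' ->]; apply/IE; exists (w + w').
  by rewrite mulmxDl [RHS]mxE.
- move=> p q /IE[w ->]; apply/IE; exists (p *: w).
  by rewrite -scalemxAl [RHS]mxE.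
Qed.

Lemma en_homogeneous : homogeneous_ideal I.
Proof.
move=> p e /IE[w ->]; apply/IE; exists (\row_a hcomp e (en_deg a) (w 0 a)).
have deg0 : en_deg base_index = 0%N by rewrite /en_deg cell0_val /cell_deg big_set0.
by rewrite (hcomp_mulmx _ _ (@en_graded 0)) [RHS]mxE deg0.
Qed.

Lemma quot_resolution : graded_free_resolution quot_complex (fun=> True) I.
Proof.
split=> //=.
- split=> [i a b u|a u]; first exact: en_graded.
  rewrite mxE msupp1 inE => /eqP ->; rewrite mdeg0 -[deg a]/(en_deg a).
  by rewrite /en_deg cell0_val /cell_deg big_set0.
- move=> p _; exists (const_mx p); rewrite mul_const1 mxE subrr.
  by case: en_ideal_closed.
- move=> v; rewrite mul_const1; split=> [/IE[w hw]|[w ->]]; last by apply/IE; exists w.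
  by exists w; apply/rowP => b; rewrite [b]cell0_index.
- move=> i v; split=> [/en_exact//|[w ->]].
  by rewrite -mulmxA en_diff2 mulmx0.
Qed.

Lemma ideal_resolution : graded_free_resolution ideal_complex I (fun p => p = 0).
Proof.
have augE a : (en_diff 0 *m const_mx 1 : 'M_(_, 1)) a 0 = en_diff 0 a base_index.
  have -> : (en_diff 0 *m const_mx 1 : 'M_(_, 1)) a 0
      = (row a (en_diff 0) *m const_mx 1 : 'M_1) 0 0 by rewrite -row_mul [RHS]mxE.
  by rewrite mul_const1 mxE.
split=> /=.
- split=> [i a b u|a u]; first exact: en_graded.
  rewrite augE => /en_graded h; rewrite -[deg a]/(en_deg a) -h.
  by rewrite /en_deg cell0_val /cell_deg big_set0 addn0.
- move=> a; rewrite augE; apply/IE; exists (delta_mx 0 a).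
  by rewrite -rowE [RHS]mxE.
- move=> p /IE[w ->]; exists w; rewrite mulmxA mul_const1; exact: subrr.
- move=> v; rewrite mulmxA mul_const1; split=> [h|[w ->]].
    apply: en_exact; apply/rowP => b; rewrite [b]cell0_index h.
    by rewrite mxE.
  by rewrite -mulmxA en_diff2 mulmx0 mxE.
- move=> i v; split=> [/en_exact//|[w ->]].
  by rewrite -mulmxA en_diff2 mulmx0.
Qed.

Lemma zero_ideal_closed : ideal_closed (fun p : S => p = 0).
Proof. by split=> [//|p q -> ->|p q ->]; rewrite ?addr0 ?mulr0. Qed.

Lemma zero_homogeneous : homogeneous_ideal (fun p : S => p = 0).
Proof. by move=> p e ->; apply/mpolyP => v; rewrite mcoeff_hcomp mcoeff0 if_same. Qed.

Lemma card_cells_deg i j :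
  #|[pred a : 'I_#|cells i| | en_deg a == j]| = #|[set c in cells i | cell_deg c == j]|.
Proof.
rewrite -[LHS]sum1_card -[RHS]sum1_card; transitivity (\sum_(c in cells i | cell_deg c == j) 1)%N.
  by rewrite (big_enum_val_cond (fun c => cell_deg c == j)); apply: eq_bigl.
by apply: eq_bigl => c; rewrite inE.
Qed.

Lemma betti_quot_cells i j :
  betti_quot I i j = #|[set c in cells i | cell_deg c == j]|.
Proof.
rewrite /betti_quot (betti_eq _ _ en_ideal_closed en_homogeneous quot_resolution).
by rewrite homologyK_minimal ?card_cells_deg // => k; apply: en_minimal.
Qed.

Lemma betti_ideal_cells i j :
  betti_ideal I i j = #|[set c in cells i.+1 | cell_deg c == j]|.
Proof.
rewrite /betti_ideal (betti_eq _ _ zero_ideal_closed zero_homogeneous ideal_resolution).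
by rewrite homologyK_minimal ?card_cells_deg // => k; apply: en_minimal.
Qed.

End Resolution.
(** * Multi-path graphs and their toric ideals *)

Section Counting.
Variables (m : nat) (l : 'I_m -> nat).

(** The index [r] becomes [q = r + 1]. A chain of [i + 1] columns forces [i < m], so [inord] is
    faithful. *)
Lemma card_cells_Eset i j : 0 < i ->
  #|[set c in cells m i | cell_deg l c == j]| = #|Eset l i j|.
Proof.
case: i => // i _.
have ltT : transitive (fun k k' : 'I_m => k < k') by move=> y x z; apply: ltn_trans.
have ltI : irreflexive (fun k k' : 'I_m => k < k') by move=> x; apply: ltnn.
pose f (kr : i.+2.-tuple 'I_m * 'I_i.+1) : cell m := ([set x in kr.1], inord kr.2.+1).
have size_m (s : i.+2.-tuple 'I_m) : uniq s -> i.+2 <= m.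
  by move=> /card_uniqP; rewrite size_tuple => <-; rewrite -[m in _ <= m]card_ord max_card.
rewrite -(@card_in_imset _ _ f (Eset l i.+1 j)); last first.
  move=> [s r] [s' r']; rewrite !inE /= => /andP[ss _] /andP[ss' _] [es er].
  have sE : s = s'.
    by apply/val_inj/(irr_sorted_eq ltT ltI ss ss') => x; move/setP/(_ x): es; rewrite !inE.
  congr (_, _) => //; have im := size_m s (sorted_uniq ltT ltI ss).
  move/(congr1 val): er; rewrite /= !inordK; first by move=> [/val_inj].
    by have := ltn_ord r'; lia.
  by have := ltn_ord r; lia.
apply: eq_card => -[A q]; rewrite inE cellsS /= /cell_deg /=.
apply/idP/imsetP => [/andP[/andP[/eqP cA /andP[q0 qi]] dA]|[[s r]]]; last first.
  rewrite inE /= => /andP[ss /eqP sj] [-> ->].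
  have us := sorted_uniq ltT ltI ss; have im := size_m s us.
  have cs : #|[set x in s]| = i.+2 by rewrite cardsE (card_uniqP us) size_tuple.
  rewrite cs eqxx inordK; last by have := ltn_ord r; lia.
  rewrite /= ltnS ltn_ord -sj; apply/eqP; rewrite [RHS]big_uniq //=.
  by apply: eq_bigl => x; rewrite inE.
have sA : size (enum A) == i.+2 by rewrite -cardE cA.
have r_lt : q.-1 < i.+1 by lia.
exists (Tuple sA, Ordinal r_lt); last first.
  congr (_, _); first by apply/setP => x; rewrite inE /= mem_enum.
  by apply: val_inj; rewrite /= prednK // inordK.
rewrite inE /=; apply/andP; split; last by rewrite -(eqP dA) big_enum.
rewrite [enum _](_ : _ = filter (mem A) (enum 'I_m)); last by rewrite enumT.
apply: sorted_filter => //.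
have : sorted ltn (map val (enum 'I_m)) by rewrite val_enum_ord iota_ltn_sorted.
by rewrite sorted_map.
Qed.

Lemma sum_card_cells_deg i N :
  \sum_(j < N) #|[set c in cells m i.+1 | cell_deg l c == j]| <= i.+1 * 'C(m, i.+2).
Proof.
apply: (@leq_trans #|cells m i.+1|).
  under eq_bigr => j _.
    rewrite -sum1_card (eq_bigl (fun c => (c \in cells m i.+1) && (cell_deg l c == j)));
      last by move=> c; rewrite inE.
    rewrite big_mkcondr; over.
  rewrite exchange_big /= -sum1_card leq_sum // => c _.
  have [dN|Nd] := ltnP (cell_deg l c) N.
    rewrite (bigD1 (Ordinal dN)) //= eqxx big1 // => j nj; case: eqP => // dj.
    by case/eqP: nj; apply: val_inj.
  by rewrite big1 // => j _; case: eqP => // dj; have := ltn_ord j; rewrite -dj ltnNge Nd.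
pose Q := [set q : 'I_m.+1 | 0 < q < i.+2].
have -> : cells m i.+1 = setX [set A : {set 'I_m} | #|A| == i.+2] Q.
  by apply/setP => c; rewrite cellsS !inE.
rewrite cardsX card_draws card_ord mulnC leq_mul2r; apply/orP; right.
rewrite -(@card_in_imset _ 'I_i.+1 (fun q : 'I_m.+1 => inord q.-1) Q).
  by rewrite -[X in _ <= X]card_ord max_card.
move=> q q'; rewrite !inE => /andP[q0 qi] /andP[q0' qi'] /(congr1 val) /=.
by rewrite !inordK; [move=> h; apply: val_inj => /=; lia|lia|lia].
Qed.

End Counting.

(** * Edges indexed by path and position *)

Section MultipathEdges.
Variables (m : nat) (l : 'I_m -> nat) (G : sgraph).
Hypothesis hl : forall k, 0 < l k.
Variables (v1 v2 : G) (P : 'I_m -> seq G).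
Hypothesis pathPk : forall k, [/\ path (@adj G) v1 (P k), last v1 (P k) = v2,
  uniq (v1 :: P k) & size (P k) = 2 * l k].
Hypothesis disjP : forall k k' x, k != k' -> x \in v1 :: P k -> x \in v1 :: P k' ->
  x = v1 \/ x = v2.
Hypothesis edgeP : forall x y, adj x y -> exists k,
  infix [:: x; y] (v1 :: P k) || infix [:: y; x] (v1 :: P k).

Definition vtx k s : G := nth v1 (v1 :: P k) s.

Lemma vtx0 k : vtx k 0 = v1. Proof. by []. Qed.

Lemma vtx_last k : vtx k (2 * l k) = v2.
Proof. by have [_ <- _ <-] := pathPk k; rewrite /vtx -last_nth. Qed.

Lemma vtx_inj k s s' : s <= 2 * l k -> s' <= 2 * l k -> vtx k s = vtx k s' -> s = s'.
Proof.
have [_ _ up sz] := pathPk k => hs hs' /eqP; rewrite /vtx nth_uniq //=.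
all: by rewrite ?sz ?ltnS // => /eqP.
Qed.

Lemma mem_vtx k s : s <= 2 * l k -> vtx k s \in v1 :: P k.
Proof. by have [_ _ _ sz] := pathPk k => hs; rewrite mem_nth //= sz. Qed.

Lemma vtx_disj k k' s s' : k != k' -> s <= 2 * l k -> s' <= 2 * l k' ->
  vtx k s = vtx k' s' -> (s = 0 /\ s' = 0) \/ (s = 2 * l k /\ s' = 2 * l k').
Proof.
move=> ne hs hs' e; have hx := mem_vtx hs; have hx' : vtx k s \in v1 :: P k'.
  by rewrite e mem_vtx.
case: (disjP ne hx hx') => ex; [left|right]; split.
- by apply: (@vtx_inj k) => //; rewrite ex.
- by apply: (@vtx_inj k') => //; rewrite -e ex.
- by apply: (@vtx_inj k) => //; rewrite ex vtx_last.
- by apply: (@vtx_inj k') => //; rewrite -e ex vtx_last.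
Qed.

(** An edge common to two paths would join [v1] to [v2] directly, but every path has length at least
    2. *)
Lemma edge_pair_inj k k' s s' : s < 2 * l k -> s' < 2 * l k' ->
  [set vtx k s; vtx k s.+1] = [set vtx k' s'; vtx k' s'.+1] -> k = k' /\ s = s'.
Proof.
move=> hs hs' e.
have h1 : vtx k s \in [set vtx k' s'; vtx k' s'.+1] by rewrite -e set21.
have h2 : vtx k s.+1 \in [set vtx k' s'; vtx k' s'.+1] by rewrite -e set22.
have [kk|ne] := eqVneq k k'.
  split=> //; move: h1 h2; rewrite -kk in hs' *; rewrite !in_set2.
  by case/orP => /eqP/vtx_inj h1; case/orP => /eqP/vtx_inj h2; lia.
move: h1 h2; rewrite !in_set2 => h1 h2; exfalso.
have l0 := hl k.
have a1 : s = 0 \/ s = 2 * l k.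
  by case/orP: h1 => /eqP/(vtx_disj ne) h1; have := h1 _ _; lia.
have a2 : s.+1 = 0 \/ s.+1 = 2 * l k.
  by case/orP: h2 => /eqP/(vtx_disj ne) h2; have := h2 _ _; lia.
lia.
Qed.

Lemma multipath_edges : exists (kappa : 'I_#|edges G| -> 'I_m) (sigma : 'I_#|edges G| -> nat),
  [/\ forall i, sigma i < 2 * l (kappa i),
      forall i, enum_val i = [set vtx (kappa i) (sigma i); vtx (kappa i) (sigma i).+1]
    & forall k s, s < 2 * l k -> exists i, kappa i = k /\ sigma i = s].
Proof.
have edge_pos (i : 'I_#|edges G|) : exists ks : 'I_m * nat,
    ks.2 < 2 * l ks.1 /\ enum_val i = [set vtx ks.1 ks.2; vtx ks.1 ks.2.+1].
  have := enum_valP i; rewrite inE => /existsP[x /existsP[y /andP[axy /eqP ->]]].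
  have infix_pos a b k : infix [:: a; b] (v1 :: P k) -> exists s,
      [/\ s < 2 * l k, vtx k s = a & vtx k s.+1 = b].
    move=> /infixP[p [q pq]]; exists (size p); have [_ _ _ sz] := pathPk k.
    split; last 2 first.
    - by rewrite /vtx pq nth_cat ltnn subnn.
    - by rewrite /vtx pq nth_cat ltnNge leqnSn subSnn.
    have := congr1 size pq; rewrite /= sz !size_cat /=; lia.
  have [k /orP[]/infix_pos[s [hs xs ys]]] := edgeP axy.
    by exists (k, s); rewrite /= xs ys.
  by exists (k, s); rewrite /= xs ys setUC.
have [ks hks] := fin_all_exists edge_pos.
exists (fun i => (ks i).1), (fun i => (ks i).2); split=> [i|i|k s hs].
- by case: (hks i).
- by case: (hks i).
have [pk _ _ sz] := pathPk k.
have he : [set vtx k s; vtx k s.+1] \in edges G.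
  rewrite inE; apply/existsP; exists (vtx k s); apply/existsP; exists (vtx k s.+1).
  by rewrite eqxx andbT; move/pathP: pk => /(_ v1 s); apply; rewrite sz.
exists (enum_rank_in he [set vtx k s; vtx k s.+1]).
have [hs' e] := hks (enum_rank_in he [set vtx k s; vtx k s.+1]).
by rewrite enum_rankK_in // in e; have [] := edge_pair_inj hs hs' e.
Qed.

End MultipathEdges.
Lemma sum_nat_eq (T : finType) (f g : T -> nat) :
  (forall i, f i <= g i) -> \sum_i f i = \sum_i g i -> f =1 g.
Proof.
move=> le e i; apply/eqP; rewrite eqn_leq le leqNgt; apply/negP => lt.
have : \sum_i f i < \sum_i g i.
  rewrite (bigD1 i) //= [X in _ < X](bigD1 i) //= -addSn leq_add //.
  by apply: leq_sum => j _.
by rewrite e ltnn.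
Qed.

(** Let [k] be the last index with [f k < g k]. Each [(f j - g j) * (w j - w k)] is at most 0, and
    it is negative wherever [g j < f j]; as the sums agree, [w k] drops out. *)
Lemma sum_weight_inj m (w f g : 'I_m -> nat) :
  (forall j k : 'I_m, j < k -> w k < w j) ->
  (forall j k : 'I_m, g j < f j -> f k < g k -> k < j) ->
  \sum_k f k = \sum_k g k -> \sum_k g k * w k <= \sum_k f k * w k -> f =1 g.
Proof.
move=> wlt sep e le.
have [/existsP[k0 fk0]|/existsPn nfg] := boolP [exists k, f k < g k]; last first.
  by move=> k; apply/esym; apply: (sum_nat_eq (f := g)) => // i; rewrite leqNgt nfg.
have [/existsP[j0 gj0]|/existsPn ngf] := boolP [exists j, g j < f j]; last first.
  by apply: sum_nat_eq => // i; rewrite leqNgt ngf.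
case: (@arg_maxnP _ k0 (fun k => f k < g k) (fun k : 'I_m => k : nat) fk0) => k fk kmax.
have term j : f j * w j + g j * w k <= g j * w j + f j * w k.
  have [gf|fg|->//] := ltngtP (g j) (f j).
    by have := wlt _ _ (sep j k gf fk); nia.
  have [/wlt wjk|kj] := ltnP j k; first by nia.
  have -> : j = k by apply/val_inj/eqP; rewrite eqn_leq kj andbT; apply: kmax.
  by rewrite addnC.
have : \sum_j (f j * w j + g j * w k) < \sum_j (g j * w j + f j * w k).
  rewrite (bigD1 j0) //= [X in _ < X](bigD1 j0) //= -addSn leq_add //.
    by have := wlt _ _ (sep j0 k gj0 fk); nia.
  by apply: leq_sum.
by rewrite !big_split /= -!big_distrl /= e ltn_add2r ltnNge le.
Qed.

(** * Fibres of the edge map and the initial ideal *)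

Section Toric.
Import Order.TTheory.
Variables (K : fieldType) (m : nat) (l : 'I_m -> nat) (G : sgraph).
Local Notation n := #|edges G|.
Local Notation S := {mpoly K[n]}.
Implicit Types (u v : 'X_{1..n}) (k : 'I_m) (p : S).
Hypothesis hl : forall k, 0 < l k.
Variables (v1 v2 : G) (vt : 'I_m -> nat -> G).
Variables (kappa : 'I_n -> 'I_m) (sigma : 'I_n -> nat).
Hypothesis sigma_lt : forall i, sigma i < 2 * l (kappa i).
Hypothesis edgeE : forall i,
  enum_val i = [set vt (kappa i) (sigma i); vt (kappa i) (sigma i).+1].
Hypothesis edge_ex : forall k s, s < 2 * l k -> exists i, kappa i = k /\ sigma i = s.
Hypothesis vt0 : forall k, vt k 0 = v1.
Hypothesis vt_last : forall k, vt k (2 * l k) = v2.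
Hypothesis vt_inj : forall k s s', s <= 2 * l k -> s' <= 2 * l k ->
  vt k s = vt k s' -> s = s'.
Hypothesis vt_disj : forall k k' s s', k != k' -> s <= 2 * l k -> s' <= 2 * l k' ->
  vt k s = vt k' s' -> (s = 0 /\ s' = 0) \/ (s = 2 * l k /\ s' = 2 * l k').
Variable first : 'I_m -> 'I_n.
Hypothesis firstP : forall k, kappa (first k) = k /\ sigma (first k) = 0.

Definition par i : bool := odd (sigma i).
Local Notation xv := (xv kappa par).
Local Notation standard := (standard kappa par).

Lemma edge_index_inj i i' : kappa i = kappa i' -> sigma i = sigma i' -> i = i'.
Proof. by move=> ek es; apply: enum_val_inj; rewrite !edgeE ek es. Qed.

Lemma sum_path k (F : nat -> nat) :
  \sum_(i | kappa i == k) F (sigma i) = \sum_(s < 2 * l k) F s.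
Proof.
transitivity (\sum_(i | kappa i == k) \sum_(s < 2 * l k | sigma i == s) F s).
  apply: eq_bigr => i /eqP ik; have h := sigma_lt i; rewrite ik in h.
  by rewrite (big_pred1 (Ordinal h)) // => s; rewrite -(inj_eq val_inj) eq_sym.
rewrite (exchange_big_dep xpredT) //=; apply: eq_bigr => s _.
have [i0 [ki si]] := edge_ex (ltn_ord s).
rewrite (big_pred1 i0) // => i; apply/andP/eqP => [[/eqP h1 /eqP h2]|->].
  by apply: edge_index_inj; rewrite ?h1 ?h2 ?ki ?si.
by rewrite ki si !eqxx.
Qed.

Lemma sum_xv e k (F : nat -> nat) :
  \sum_i xv e k i * F (sigma i) = \sum_(s < 2 * l k) (odd s == ~~ e) * F s.
Proof.
rewrite -(sum_path k (fun s => (odd s == ~~ e) * F s)) [RHS]big_mkcond /=.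
by apply: eq_bigr => i _; rewrite mnmE /par; case: (kappa i == k).
Qed.

(** Edges of one parity cover each vertex of the path once, except the last for [e = true] and the
    first for [e = false]. *)
Lemma sum_parity (e : bool) L (f : nat -> nat) :
  \sum_(s < 2 * L) (odd s == ~~ e) * (f s + f s.+1) = \sum_(s < 2 * L) f (s + ~~ e).
Proof.
elim: L => [|L IHL]; first by rewrite !muln0 !big_ord0.
rewrite mulnS add2n !big_ord_recr /= IHL oddM /=.
by case: e {IHL} => /=; rewrite ?addn0 ?addn1; lia.
Qed.

Lemma mdeg_xv e k : mdeg (xv e k) = l k.
Proof.
rewrite mdegE; under eq_bigr do rewrite -[xv e k _]muln1.
rewrite (sum_xv e k (fun=> 1)); elim: (l k) => [|L IHL]; first by rewrite muln0 big_ord0.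
by rewrite mulnS add2n !big_ord_recr /= IHL oddM /=; case: (e); lia.
Qed.

Definition wt u : nat := \sum_(i | sigma i == 0) u i * omega (kappa i).

Lemma wtD u v : wt (u + v)%MM = wt u + wt v.
Proof. by rewrite /wt -big_split; apply: eq_bigr => i _; rewrite mnmDE mulnDl. Qed.

Lemma sum_first (F : 'I_n -> nat) : \sum_(i | sigma i == 0) F i = \sum_k F (first k).
Proof.
rewrite (reindex_onto first kappa) /=; last first.
  by move=> i /eqP si; have [h1 h2] := firstP (kappa i); apply: edge_index_inj; rewrite ?h2.
by apply: eq_bigl => k; have [-> ->] := firstP k; rewrite !eqxx.
Qed.

Lemma wt_first u : wt u = \sum_k u (first k) * omega k.
Proof. by rewrite /wt sum_first; apply: eq_bigr => k _; have [-> _] := firstP k. Qed.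

Lemma wt_xv e k : wt (xv e k) = e * omega k.
Proof.
rewrite wt_first (bigD1 k) //= big1 ?addn0 => [|j /negPf njk]; rewrite mnmE /par.
  by have [-> ->] := firstP k; rewrite eqxx /=; case: e.
by have [-> ->] := firstP j; rewrite njk.
Qed.

(** The exponent of [x] in the image of ['X_[u]] under [edge_map]. *)
Definition inc u (x : G) : nat := \sum_i u i * (x \in enum_val i).

Lemma incD u v x : inc (u + v)%MM x = inc u x + inc v x.
Proof. by rewrite /inc -big_split; apply: eq_bigr => i _; rewrite mnmDE mulnDl. Qed.

Lemma inc_xv e k x : inc (xv e k) x = \sum_(s < 2 * l k) (x == vt k (s + ~~ e)).
Proof.
rewrite -(sum_parity e (l k) (fun s => x == vt k s)).
rewrite -(sum_xv e k (fun s => (x == vt k s) + (x == vt k s.+1))).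
apply: eq_bigr => i _; rewrite mnmE edgeE in_set2.
case: eqP => //= ik; case: (_ == _); rewrite ?mul0n // !mul1n -ik.
case: eqP => //= ->; case: eqP => //= /vt_inj.
by have := sigma_lt i => h /(_ (ltnW h) h); lia.
Qed.

(** On its path [a_k] misses only [v2] and [b_k] only [v1], so their images differ by the same
    factor for every [k]. *)
Lemma inc_swap j k x : inc (xv true j + xv false k)%MM x = inc (xv true k + xv false j)%MM x.
Proof.
have shift i : inc (xv true i) x + (x == v2) = inc (xv false i) x + (x == v1).
  rewrite !inc_xv /=; transitivity (\sum_(s < (2 * l i).+1) (x == vt i s)).
    by rewrite big_ord_recr /= vt_last; under eq_bigr do rewrite addn0.
  by rewrite big_ord_recl vt0 addnC; under [in RHS]eq_bigr do rewrite addn1.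
by rewrite !incD; have := shift j; have := shift k; lia.
Qed.

Lemma inc_v1 u : inc u v1 = \sum_k u (first k).
Proof.
rewrite -sum_first big_mkcond; apply: eq_bigr => i _; rewrite edgeE in_set2.
have h := sigma_lt i; rewrite -(vt0 (kappa i)); case: (sigma i =P 0) => [->|s0].
  by rewrite eqxx muln1.
case: eqP => [/(vt_inj (leq0n _) (ltnW h)) e|_]; first by case: s0.
by case: eqP => [/(vt_inj (leq0n _) h)|_]; last rewrite muln0.
Qed.

Lemma inc_inner u i i' : kappa i = kappa i' -> sigma i' = (sigma i).+1 ->
  inc u (vt (kappa i') (sigma i')) = u i + u i'.
Proof.
move=> ek es; have ne : i' != i by apply: contra_eq_neq es => ->; lia.
have h' := sigma_lt i'; have l0 := hl (kappa i').
rewrite /inc (bigD1 i) //= (bigD1 i') //= big1 ?addn0 => [|j /andP[nji njj]].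
  by rewrite !edgeE ek es set22 set21 !muln1.
rewrite edgeE in_set2; have hj := sigma_lt j.
have [kj|nk] := eqVneq (kappa i') (kappa j).
  have hj' : sigma j < 2 * l (kappa i') by rewrite kj.
  have s1 : vt (kappa i') (sigma i') != vt (kappa j) (sigma j).
    apply/eqP; rewrite -kj => /(vt_inj (ltnW h') (ltnW hj')) e.
    by case/eqP: njj; apply: edge_index_inj.
  have s2 : vt (kappa i') (sigma i') != vt (kappa j) (sigma j).+1.
    apply/eqP; rewrite -kj => /(vt_inj (ltnW h') hj') e.
    case/eqP: nji; apply: edge_index_inj; first by rewrite ek kj.
    by apply: succn_inj; rewrite -es e.
  by rewrite (negPf s1) (negPf s2) muln0.
have s1 : vt (kappa i') (sigma i') != vt (kappa j) (sigma j).
  by apply/eqP => /(vt_disj nk (ltnW h') (ltnW hj)); lia.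
have s2 : vt (kappa i') (sigma i') != vt (kappa j) (sigma j).+1.
  by apply/eqP => /(vt_disj nk (ltnW h') hj); lia.
by rewrite (negPf s1) (negPf s2) muln0.
Qed.

(** An inner vertex lies on exactly two edges, so [u - v] changes sign from each edge of a path to
    the next. *)
Lemma inc_parity u v i : inc u =1 inc v ->
  if odd (sigma i) then u i + u (first (kappa i)) = v i + v (first (kappa i))
  else u i + v (first (kappa i)) = v i + u (first (kappa i)).
Proof.
move=> huv; move es : (sigma i) => s; elim: s i es => [|s IHs] i es.
  have -> : first (kappa i) = i
    by apply: edge_index_inj; have [h1 h2] := firstP (kappa i); rewrite ?es.
  by rewrite addnC.
have [|i0 [k0 s0]] := @edge_ex (kappa i) s; first by have := sigma_lt i; lia.
have := IHs i0 s0; rewrite k0 /=.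
have := inc_inner u k0; have := inc_inner v k0; rewrite s0 => /(_ es) e1 /(_ es) e2.
have := huv (vt (kappa i) (sigma i)); rewrite e1 e2.
by case: (odd s) => /=; lia.
Qed.

(** A path whose first exponent is larger in [u] gives [a_j] dividing [u], one where it is smaller
    gives [b_k] dividing [u]. Standardness puts the former after the latter, where [omega] is
    smaller; the exponent of [v1] fixes the sum. *)
Lemma fiber_inj u v : standard u -> inc u =1 inc v -> wt v <= wt u -> u = v.
Proof.
move=> hu huv; rewrite !wt_first => hw.
have hf : (fun k => u (first k)) =1 (fun k => v (first k)).
  apply: (sum_weight_inj (w := @omega m)) => //; first exact: omega_lt.
    move=> j k /= gj gk; rewrite ltn_neqAle; apply/andP; split.
      by apply: contraTneq gj => /val_inj <-; rewrite -leqNgt ltnW.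
    apply: hu; apply/mnm_lepP => i; rewrite mnmE /par.
      case: eqP => //= ik; have := inc_parity i huv; rewrite ik.
      by case: odd => //=; lia.
    case: eqP => //= ik; have := inc_parity i huv; rewrite ik.
    by case: odd => //=; lia.
  by rewrite -!inc_v1 huv.
apply/mnmP => i; have := inc_parity i huv; have := hf (kappa i) => /=.
by case: odd; lia.
Qed.

Local Open Scope ring_scope.

Definition vertex_mon u : 'X_{1..#|G|} := [multinom inc u (enum_val y) | y < #|G|].

Lemma vertex_mon_eq u v : vertex_mon u = vertex_mon v <-> inc u =1 inc v.
Proof.
split=> [/mnmP h x|h]; last by apply/mnmP => y; rewrite !mnmE h.
by have := h (enum_rank x); rewrite !mnmE enum_rankK.
Qed.

Lemma edge_mapX u : edge_map ('X_[u] : S) = 'X_[vertex_mon u].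
Proof.
have mon i : edge_monomial K i
    = 'X_[[multinom ((enum_val y \in (enum_val i : {set G})) : nat) | y < #|G|]].
  rewrite /edge_monomial mprodXE; congr 'X_[_]; apply/mnmP => y.
  rewrite mnm_sumE mnmE.
  have U1 x : U_(enum_rank x)%MM y = (x == enum_val y) :> nat.
    by rewrite mnm1E -(inj_eq enum_val_inj) enum_rankK.
  under eq_bigr do rewrite U1.
  case: (boolP (enum_val y \in _)) => hy; last first.
    by rewrite big1 // => x hx; case: eqP hx => // ->; rewrite (negPf hy).
  by rewrite (bigD1 (enum_val y)) //= eqxx big1 // => x /andP[_ /negPf ->].
rewrite /edge_map mmapX /mmap1; under eq_bigr do rewrite mon.
rewrite mprodXnE; congr 'X_[_]; apply/mnmP => y; rewrite mnm_sumE mnmE.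
by apply: eq_bigr => i _; rewrite mulmnE mnmE mulnC.
Qed.

Lemma edge_mapM p q : edge_map (p * q) = edge_map p * edge_map q.
Proof. exact: (rmorphM (mmap (@mpolyC #|G| K) (@edge_monomial K G))). Qed.

Lemma edge_map_sum p :
  edge_map p = \sum_(u <- msupp p) p@_u *: 'X_[vertex_mon u].
Proof.
rewrite [p in LHS]mpolyE /edge_map raddf_sum /=; apply: eq_bigr => u _.
by rewrite mmapZ mul_mpolyC -edge_mapX.
Qed.

(** Alone in its fibre, [u] would leave its coefficient uncancelled in [edge_map p]. *)
Lemma toric_not_standard p u : edge_map p = 0 -> u \in msupp p ->
  (forall v, v \in msupp p -> inc u =1 inc v -> u = v) -> False.
Proof.
move=> p0 up h; have := congr1 (mcoeff (vertex_mon u)) p0.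
rewrite edge_map_sum raddf_sum mcoeff0 (bigD1_seq u) ?msupp_uniq //= mcoeffZ mcoeffX eqxx.
rewrite mulr1 big_seq_cond big1 ?addr0 => [|v /andP[vp nvu]].
  by move=> /eqP; rewrite mcoeff_eq0 up.
rewrite mcoeffZ mcoeffX; case: eqP => [/esym/vertex_mon_eq/(h v vp) e|_]; last exact: mulr0.
by rewrite e eqxx in nvu.
Qed.

Definition le_wt : rel 'X_{1..n} :=
  fun u v => (wt u < wt v)%N || ((wt u == wt v) && (u <= v)%O).

Lemma le_wt_order : monomial_order le_wt.
Proof.
split; first split.
- by move=> u; rewrite /le_wt eqxx lexx orbT.
- move=> u v /andP[]; rewrite /le_wt; case: ltngtP => //= _ h1 h2.
  by apply: le_anti; rewrite h1 h2.
- move=> v u w; rewrite /le_wt.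
  case: (ltngtP (wt u) (wt v)) => //= [uv _|->].
    by case: (ltngtP (wt v) (wt w)) => //= [vw _|<- _]; rewrite ?(ltn_trans uv vw) ?uv.
  by move=> uv; case: ltngtP => //= _; apply: le_trans.
- move=> u v; rewrite /le_wt; case: ltngtP => //= _; exact: le_total.
- move=> u v w; rewrite /le_wt !wtD ltn_add2r eqn_add2r lemc_add2l; exact.
- move=> u; rewrite /le_wt; have -> : wt 0%MM = 0%N.
    by rewrite /wt big1 // => i _; rewrite mnm0E.
  by case: (wt u) => //=; exact: le0m.
Qed.

Lemma le_wt_le u v : le_wt u v -> (wt u <= wt v)%N.
Proof. by move=> /orP[/ltnW//|/andP[/eqP->]]. Qed.

Lemma not_standardD u v : ~ standard u -> ~ standard (v + u)%MM.
Proof.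
move=> nu h; apply: nu => j k hj hk.
by apply: h; [apply: lepm_trans hj _|apply: lepm_trans hk _]; apply: lem_addl.
Qed.

(** Exponents of the generators of the initial ideal. *)
Definition steps (u : 'X_{1..n}) : Prop :=
  exists j k : 'I_m, (j < k)%N /\ u = (xv true j + xv false k)%MM.

Lemma leading_not_standard p u : toric_ideal p -> leading_monomial le_wt p u -> ~ standard u.
Proof.
move=> p0 [up lead] us; apply: (toric_not_standard p0 up) => v vp huv.
by apply: fiber_inj => //; apply: le_wt_le; apply: lead.
Qed.

Lemma steps_leading u : steps u ->
  exists p w, [/\ toric_ideal p, leading_monomial le_wt p w & 'X_[u] = 'X_[w] :> S].
Proof.
move=> [j [k [jk ->]]]; set u0 := (xv true j + _)%MM.
pose w := (xv true k + xv false j)%MM; exists ('X_[u0] - 'X_[w]), u0.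
have wt_lt : (wt w < wt u0)%N by rewrite !wtD !wt_xv !mul1n !mul0n !addn0 omega_lt.
have ne : u0 != w by apply: contraTneq wt_lt => ->; rewrite ltnn.
split=> //.
- rewrite /toric_ideal /edge_map mmapB -!/(edge_map _) !edge_mapX.
  rewrite (_ : vertex_mon u0 = vertex_mon w) ?subrr //.
  by apply/vertex_mon_eq => x; apply: inc_swap.
- split=> [|v].
    by rewrite mcoeff_msupp mcoeffB !mcoeffX eqxx [w == u0]eq_sym (negPf ne) subr0 oner_eq0.
  move=> /msuppB_le; rewrite mem_cat !msuppX !inE => /orP[]/eqP->.
    by rewrite /le_wt eqxx lexx orbT.
  by rewrite /le_wt wt_lt.
Qed.

Lemma steps_span p : (forall v, v \in msupp p -> ~ standard v) ->
  ideal_span (fun q => exists2 u, steps u & q = 'X_[u]) p.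
Proof.
move=> hp.
have stepE v : v \in msupp p -> exists u, steps u /\ (u <= v)%MM.
  move=> /hp nst; apply: NNPP => nex; apply: nst => j k hj hk.
  rewrite leqNgt; apply/negP => jk; apply: nex.
  exists (xv true j + xv false k)%MM; split; first by exists j, k.
  by apply: xv_add_le => //; apply: contraTneq jk => ->; rewrite ltnn.
pose g v := epsilon (inhabits 0%MM) (fun u => steps u /\ (u <= v)%MM).
have gP v : v \in msupp p -> steps (g v) /\ (g v <= v)%MM.
  by move=> /stepE; apply: (epsilon_spec _ (fun u => steps u /\ (u <= v)%MM)).
exists [seq (p@_v *: 'X_[v - g v], 'X_[g v]) | v <- msupp p]; split.
  by move=> c /mapP[v /gP[h _] ->] /=; exists (g v).
rewrite big_map [LHS]mpolyE [LHS]big_seq [RHS]big_seq; apply: eq_bigr => v /gP[_ le].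
by rewrite /= -scalerAl -mpolyXD submK.
Qed.

Lemma initial_idealE p : initial_ideal le_wt (@toric_ideal K G) p <->
  (forall v, v \in msupp p -> ~ standard v).
Proof.
split=> [[s [hs ->]] v|/steps_span[s [hs ->]]].
  rewrite mcoeff_msupp => /negP + vs; apply; apply/eqP.
  rewrite raddf_sum big_seq big1 // => c /hs[q [w [q0 lead ->]]]; apply/eqP.
  apply: contraT; rewrite -mcoeff_msupp => /msuppM_le/allpairsP[[a b] [/= _ hb ev]].
  rewrite msuppX inE in hb; move: vs; rewrite ev (eqP hb) => /not_standardD; case.
  exact: leading_not_standard lead.
by exists s; split=> // c /hs[u /steps_leading[q [w h]] ->]; exists q, w.
Qed.

Lemma initial_squarefree : squarefree_ideal (initial_ideal le_wt (@toric_ideal K G)).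
Proof.
exists steps; split=> [u [j [k [jk ->]]] i|p].
  rewrite mnmDE !mnmE /=; case: eqP => [->|_] /=; last by case: (_ && _).
  (* Distinct columns share no variable. *)
  have -> : (j == k) = false by apply: contraTF jk => /eqP ->; rewrite ltnn.
  by case: (_ == _).
split=> [/initial_idealE/steps_span//|[s [hs ->]]].
by exists s; split=> // c /hs[u /steps_leading[q [w h]] ->]; exists q, w.
Qed.

Variable k0 : 'I_m.

(** At [t = 1] only signs remain, and exchanging the two columns preserves the image monomial. *)
Lemma edge_map_delta c : edge_map (delta kappa par (1 : K) c (set0, ord0)) = 0.
Proof.
rewrite /delta eqxx.
have -> : \sum_B dx kappa par 1 true 1 c.1 B * dx kappa par 1 false 0 B set0
    = \sum_k \sum_j dterm kappa par (1 : K) true false 1 c.1 set0 k j.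
  exact: (@dx_dx K n m kappa par 1 true false 1 c.1 set0 isT).
rewrite /edge_map raddf_sum; under eq_bigr do rewrite raddf_sum.
apply: sum_antisym => [k j|k]; last by rewrite /dterm eqxx !andbF raddf0.
rewrite dtermC raddfN; congr (- _); rewrite /dterm.
case: ifP => _; last by rewrite !raddf0.
rewrite /= !expr1n !mulr1 !mmapZ -!/(edge_map _) !edge_mapX; congr (_ * 'X_[_]).
by apply/vertex_mon_eq => x; rewrite addmC inc_swap.
Qed.

(** The remainder has only standard monomials. Of two in one fibre [fiber_inj] applies to the
    heavier, so they coincide, and a remainder in the toric ideal is 0. *)
Lemma toric_ideal_en p : toric_ideal p <->
  exists w : 'rV[S]_#|cells m 1|, p = (w *m en_diff kappa par 1 0) 0 (base_index m).
Proof.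
have edge_en (w : 'rV[S]_#|cells m 1|) :
    edge_map ((w *m en_diff kappa par 1 0) 0 (base_index m)) = 0.
  rewrite mxE /edge_map raddf_sum big1 //= => a _.
  by rewrite -!/(edge_map _) edge_mapM mxE cell0_val edge_map_delta mulr0.
split=> [p0|[w ->]]; last exact: edge_en.
have [w hw] := en_reduce 1 k0 wtD wt_xv p.
exists w; apply/eqP; rewrite -subr_eq0; apply/eqP/mpolyP => u; rewrite mcoeff0.
apply/eqP; apply: contraT; rewrite -mcoeff_msupp => up; exfalso.
apply: (toric_not_standard _ up) => [|v vp huv].
  by rewrite /edge_map mmapB -!/(edge_map _) edge_en p0 subrr.
have [le|/ltnW le] := leqP (wt v) (wt u); first exact: fiber_inj (hw _ up) huv le.
by apply/esym; apply: fiber_inj (hw _ vp) _ le => x; rewrite huv.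
Qed.

(** The remainder is standard, yet its monomials come from [p] or from the image, where all are
    nonstandard. *)
Lemma initial_ideal_en p : initial_ideal le_wt (@toric_ideal K G) p <->
  exists w : 'rV[S]_#|cells m 1|, p = (w *m en_diff kappa par 0 0) 0 (base_index m).
Proof.
have msupp_en (w : 'rV[S]_#|cells m 1|) v :
    v \in msupp ((w *m en_diff kappa par 0 0) 0 (base_index m)) -> ~ standard v.
  rewrite mcoeff_msupp => /negP + vs; apply; apply/eqP.
  rewrite mxE raddf_sum big1 // => a _; apply/eqP; apply: contraT.
  rewrite -mcoeff_msupp mxE cell0_val => /msuppM_le/allpairsP[[u z] [/= _ hz ev]].
  move: vs hz; rewrite ev mcoeff_msupp => vs /delta_set0_neq0[k [j [kA jA _ ez cne]]].
  (* If [k] were not the least column, the exponent of [t = 0] would be positive. *)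
  have pk : pos (enum_val a).1 k = 0%N.
    apply/eqP; apply: contraNT cne => pk; rewrite /dcoef expr0n.
    have : true = ~~ (pos (enum_val a).1 k < 1)%N by rewrite -leqNgt lt0n pk.
    by move=> /(weight_lt kA (ltnSn 0)); rewrite -subn_gt0 lt0n => /negPf ->; rewrite mulr0.
  have jk : (j <= k)%N.
    apply: vs; rewrite ez; apply: lepm_trans (lem_addl _ _); [exact: lem_addr|exact: lem_addl].
  move: jA; rewrite in_setD1 => /andP[njk jA].
  have : (j < k)%N by rewrite ltn_neqAle njk.
  by move=> /(pos_lt jA); rewrite pk.
split=> [/initial_idealE hp|[w ->]]; last by apply/initial_idealE => v; apply: msupp_en.
have [w hw] := en_reduce 0 k0 wtD wt_xv p.
exists w; apply/eqP; rewrite -subr_eq0; apply/eqP/mpolyP => u; rewrite mcoeff0.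
apply/eqP; apply: contraT; rewrite -mcoeff_msupp => up; exfalso.
have := hw _ up; move/msuppB_le: up; rewrite mem_cat => /orP[/hp//|].
exact: msupp_en.
Qed.

End Toric.

Theorem corollary4p6 (K : fieldType) (m : nat) (hm : 2 <= m)
    (l : 'I_m -> nat) (hl : forall k : 'I_m, 0 < l k)
    (G : sgraph) (hG : multipath_graph (fun k : 'I_m => 2 * l k) G) :
  exists le : rel 'X_{1..#|edges G|},
    [/\ monomial_order le,
        squarefree_ideal (initial_ideal le (@toric_ideal K G)),
        (forall i N : nat,
           \sum_(j < N) betti_ideal (initial_ideal le (@toric_ideal K G)) i j
             <= i.+1 * 'C(m, i.+2))
      & (forall i j : nat, 1 <= i -> 1 <= j ->
           betti_quot (@toric_ideal K G) i j
             = betti_quot (initial_ideal le (@toric_ideal K G)) i j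
           /\ betti_quot (initial_ideal le (@toric_ideal K G)) i j
             = #|Eset l i j|)].
Proof.
have [v1 [v2 [P [_ pathPk disjP _ edgeP]]]] := hG.
have [kappa [sigma [sigma_lt edgeE edge_ex]]] := multipath_edges hl pathPk disjP edgeP.
have k0 : 'I_m := Ordinal (ltnW hm).
have edge_ex0 k : exists i, kappa i = k /\ sigma i = 0.
  by apply: edge_ex; rewrite muln_gt0 hl.
have [first firstP] := fin_all_exists edge_ex0.
have vt0 := vtx0 v1 P; have vt_last := vtx_last pathPk.
have vt_inj := vtx_inj pathPk; have vt_disj := vtx_disj pathPk disjP.
have wtD' := wtD kappa sigma.
have wt_xv' := wt_xv edgeE firstP.
have mdeg_xv' := mdeg_xv sigma_lt edgeE edge_ex.
have toricE := toric_ideal_en hl sigma_lt edgeE edge_ex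
  vt0 vt_last vt_inj vt_disj firstP k0 (K := K).
have initE := initial_ideal_en hl sigma_lt edgeE edge_ex
  vt0 vt_last vt_inj vt_disj firstP k0 (K := K).
exists (le_wt kappa sigma); split.
- exact: le_wt_order.
- exact: (initial_squarefree K hl sigma_lt edgeE edge_ex vt0 vt_last vt_inj vt_disj firstP).
- move=> i N; under eq_bigr do rewrite (betti_ideal_cells k0 wtD' wt_xv' mdeg_xv' hl initE).
  exact: sum_card_cells_deg.
- move=> i j i1 j1.
  rewrite (betti_quot_cells k0 wtD' wt_xv' mdeg_xv' hl toricE).
  by rewrite (betti_quot_cells k0 wtD' wt_xv' mdeg_xv' hl initE) card_cells_Eset.
Qed.
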